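(* Let $M\subset\mathbb{R}^m$ and $N\subset\mathbb{R}^n$ be semialgebraic sets. The rings $\mathcal{S}^*(N)$ and $\mathcal{S}^*(M)$ are isomorphic if and only if the semialgebraic sets $N\setminus\eta(N)$ and $M\setminus\eta(M)$ are semialgebraically homeomorphic.
   Context: A map $f:M\to\mathbb{R}^n$ on a semialgebraic set $M\subset\mathbb{R}^m$ is called semialgebraic if it is continuous and its graph is a semialgebraic subset of $\mathbb{R}^{m+n}$. $\mathcal{S}^*(M)$ denotes the commutative unital ring of all bounded (continuous) semialgebraic functions $M\to\mathbb{R}$ with pointwise operations. A semialgebraic homeomorphism is a semialgebraic map that is a homeomorphism; two semialgebraic sets are semialgebraically homeomorphic if there is a semialgebraic homeomorphism between them. For a semialgebraic set $M$, $\eta(M)$ is the (finite) set of points $p\in M$ that have an open neighborhood in $M$ that is semialgebraically homeomorphic to the interval $[0,1)$ by a homeomorphism sending $p$ to $0$. *)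

(* Defs.v *)
From HB Require Import structures.
From mathcomp Require Import all_boot all_order all_algebra.
From mathcomp Require Import all_classical all_reals topology normedtype.
From mathcomp Require mpoly ordered_qelim qe_rcf.

Set Implicit Arguments.
Unset Strict Implicit.
Unset Printing Implicit Defensive.

Import Order.TTheory GRing.Theory Num.Theory.
Import numFieldNormedType.Exports.
Import (canonicals) mpoly.

Local Open Scope classical_set_scope.
Local Open Scope ring_scope.

(* R^n is 'rV[R]_n. The semialgebraic subsets of R^n are the finite boolean
   combinations of polynomial equalities and strict inequalities.             *)
Inductive semialgebraic (R : realType) (n : nat) : set 'rV[R]_n -> Prop :=
| semialgebraic_eq (p : mpoly.mpoly n R) :
    semialgebraic [set x | mpoly.meval (x 0) p = 0]
| semialgebraic_gt (p : mpoly.mpoly n R) :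
    semialgebraic [set x | 0 < mpoly.meval (x 0) p]
| semialgebraicU (A B : set 'rV[R]_n) :
    semialgebraic A -> semialgebraic B -> semialgebraic (A `|` B)
| semialgebraicC (A : set 'rV[R]_n) :
    semialgebraic A -> semialgebraic (~` A).

(* A set M coerces to the subtype of its elements, which carries the subspace
   topology; maps on M are functions on this subtype.                         *)
Definition map_graph (R : realType) (m n : nat) (M : set 'rV[R]_m)
    (f : M -> 'rV[R]_n) : set 'rV[R]_(m + n) :=
  [set z | exists x : M, z = row_mx (\val x) (f x)].

Definition semialgebraic_map (R : realType) (m n : nat) (M : set 'rV[R]_m)
    (f : M -> 'rV[R]_n) : Prop :=
  continuous f /\ semialgebraic (map_graph f).

Definition semialgebraic_homeo (R : realType) (m n : nat) (M : set 'rV[R]_m)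
    (N : set 'rV[R]_n) (f : M -> N) : Prop :=
  semialgebraic_map (fun x => \val (f x)) /\
  exists g : N -> M, [/\ cancel f g, cancel g f, continuous f & continuous g].

Definition semialgebraic_homeomorphic (R : realType) (m n : nat)
    (M : set 'rV[R]_m) (N : set 'rV[R]_n) : Prop :=
  exists f : M -> N, semialgebraic_homeo f.

(* The interval [0, 1) as a subset of R^1 *)
Definition unit_co (R : realType) : set 'rV[R]_1 :=
  [set t | 0 <= t 0 0 < 1].
Arguments unit_co R : clear implicits.

(* The set eta(M). The open neighborhoods in M are the sets M `&` O with O open
   in R^m.                                                                    *)
Definition end_points (R : realType) (m : nat) (M : set 'rV[R]_m) :
    set 'rV[R]_m :=
  [set p | exists O : set 'rV[R]_m, open O /\ semialgebraic (M `&` O) /\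
    exists (x : (M `&` O)%classic) (f : (M `&` O)%classic -> unit_co R),
      [/\ \val x = p, semialgebraic_homeo f & \val (f x) = 0]].

(* f : M -> R is identified with the map x |-> const_mx (f x) to R^1. *)
Definition bounded_semialgebraic (R : realType) (m : nat) (M : set 'rV[R]_m) :
    {pred (M -> R)} :=
  fun f => `[< [/\ continuous f,
    semialgebraic (map_graph (fun x => const_mx (f x) : 'rV[R]_1)) &
    bounded_fun f] >].

Section Tarski_Seidenberg.
Variable R : realType.

Lemma semialgebraicI n (A B : set 'rV[R]_n) :
  semialgebraic A -> semialgebraic B -> semialgebraic (A `&` B).
Proof.
move=> hA hB; rewrite -[A]setCK -[B]setCK -setCU.
by apply: semialgebraicC; apply: semialgebraicU; apply: semialgebraicC.
Qed.

Lemma semialgebraic_bool n (b : bool) : semialgebraic [set x : 'rV[R]_n | b].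
Proof.
have e0 : semialgebraic [set x : 'rV[R]_n | 0 < mpoly.meval (x 0) 0].
  exact: semialgebraic_gt.
have E : [set x : 'rV[R]_n | 0 < mpoly.meval (x 0) 0] = set0.
  by apply/seteqP; split=> x //=; rewrite mpoly.meval0 ltxx.
rewrite E in e0; case: b.
  have -> : [set x : 'rV[R]_n | true] = ~` set0 by rewrite setC0; exact/seteqP.
  exact: semialgebraicC.
suff -> : [set x : 'rV[R]_n | false] = set0 by [].
by apply/seteqP; split.
Qed.

Lemma semialgebraic_preimage m n (q : 'I_n -> mpoly.mpoly m R)
    (S : set 'rV[R]_n) : semialgebraic S ->
  semialgebraic [set x | S (\row_i mpoly.meval (x 0) (q i))].
Proof.
have subst p : exists p', forall x : 'rV[R]_m, mpoly.meval (x 0) p' =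
    mpoly.meval ((\row_i mpoly.meval (x 0) (q i)) 0) p.
  exists (mpoly.comp_mpoly [tuple q i | i < n] p) => x.
  rewrite mpoly.comp_mpoly_meval; apply: mpoly.meval_eq => i.
  by rewrite mxE tnth_mktuple.
elim=> {S} [p|p|A B _ hA _ hB|A _ hA].
- have [p' E] := subst p.
  have := semialgebraic_eq p'; congr semialgebraic.
  by apply/seteqP; split=> x /=; rewrite E.
- have [p' E] := subst p.
  have := semialgebraic_gt p'; congr semialgebraic.
  by apply/seteqP; split=> x /=; rewrite E.
- exact: (semialgebraicU hA hB).
- exact: (semialgebraicC hA).
Qed.

Let env n (x : 'rV[R]_n) : seq R := [seq x 0 i | i <- enum 'I_n].

Let nth_env n (x : 'rV[R]_n) (i : 'I_n) : (env x)`_i = x 0 i.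
Proof. by rewrite (nth_map i) ?size_enum_ord // nth_ord_enum. Qed.

Let nth_env_ge n (x : 'rV[R]_n) k : (n <= k)%N -> (env x)`_k = 0.
Proof. by move=> nk; rewrite nth_default // size_map size_enum_ord. Qed.

Let term_of_mpoly n (p : mpoly.mpoly n R) : exists t : GRing.term R,
  forall x : 'rV[R]_n, GRing.eval (env x) t = mpoly.meval (x 0) p.
Proof.
elim/mpoly.mpolyind: p => [|c m p _ _ [t Et]].
  by exists (GRing.Const 0) => x; rewrite mpoly.meval0.
pose mon := \big[(@GRing.Mul R)/GRing.Const 1]_(i < n)
  GRing.Exp (GRing.Var R i) (mpoly.fun_of_multinom m i).
exists (GRing.Add (GRing.Mul (GRing.Const c) mon) t) => x /=.
rewrite mpoly.mevalD mpoly.mevalZ Et mpoly.mevalX; congr (_ * _ + _).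
rewrite /mon (big_morph (GRing.eval (env x)) (id1 := 1) (op1 := *%R)) //.
by apply: eq_bigr => i _ /=; rewrite nth_env.
Qed.

Let mpoly_of_term n (t : GRing.term R) : GRing.rterm t ->
  exists p : mpoly.mpoly n R,
  forall x : 'rV[R]_n, GRing.eval (env x) t = mpoly.meval (x 0) p.
Proof.
elim: t => //=.
- move=> k _; case: (ltnP k n) => [kn|nk].
    exists (mpoly.mpolyX R (mpoly.mnm1 (Ordinal kn))) => x.
    by rewrite mpoly.mevalXU -nth_env.
  by exists 0 => x; rewrite nth_env_ge // mpoly.meval0.
- by move=> c _; exists (mpoly.mpolyC n c) => x; rewrite mpoly.mevalC.
- by move=> k _; exists (mpoly.mpolyC n k%:R) => x; rewrite mpoly.mevalC.
- move=> t1 IH1 t2 IH2 /andP[/IH1[p1 E1] /IH2[p2 E2]].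
  by exists (p1 + p2) => x; rewrite mpoly.mevalD E1 E2.
- by move=> t IH /IH[p E]; exists (- p) => x; rewrite mpoly.mevalN E.
- move=> t IH k /IH[p E].
  by exists (p *+ k) => x; rewrite mpoly.mevalMn E.
- move=> t1 IH1 t2 IH2 /andP[/IH1[p1 E1] /IH2[p2 E2]].
  by exists (p1 * p2) => x; rewrite mpoly.mevalM E1 E2.
- move=> t IH k /IH[p E].
  by exists (p ^+ k) => x; rewrite rmorphXn /= E.
Qed.

Import ordered_qelim.ord.

Let formula_of_semialgebraic n (S : set 'rV[R]_n) : semialgebraic S ->
  exists f : formula R, forall x, S x <-> holds (env x) f.
Proof.
elim=> {S} [p|p|A B _ [f hf] _ [g hg]|A _ [f hf]].
- by have [t Et] := term_of_mpoly p; exists (Equal t (GRing.Const 0)) => x /=;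
    rewrite Et.
- by have [t Et] := term_of_mpoly p; exists (Lt (GRing.Const 0) t) => x /=;
    rewrite Et.
- by exists (Or f g) => x /=; rewrite -hf -hg.
- by exists (Not f) => x /=; rewrite -hf.
Qed.

Let semialgebraic_qf n (f : formula R) : qf_form f -> rformula f ->
  semialgebraic [set x : 'rV[R]_n | qf_eval (env x) f].
Proof.
elim: f => //=.
- by move=> b _ _; exact: semialgebraic_bool.
- move=> t1 t2 _ /andP[/(mpoly_of_term n)[p1 E1] /(mpoly_of_term n)[p2 E2]].
  have := semialgebraic_eq (p1 - p2); congr semialgebraic.
  apply/seteqP; split=> x /=; rewrite mpoly.mevalB -E1 -E2.
    by move/subr0_eq ->.
  by move=> /eqP ->; rewrite subrr.
- move=> t1 t2 _ /andP[/(mpoly_of_term n)[p1 E1] /(mpoly_of_term n)[p2 E2]].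
  have := semialgebraic_gt (p2 - p1); congr semialgebraic.
  by apply/seteqP; split=> x /=; rewrite mpoly.mevalB -E1 -E2 subr_gt0.
- move=> t1 t2 _ /andP[/(mpoly_of_term n)[p1 E1] /(mpoly_of_term n)[p2 E2]].
  have := semialgebraicC (semialgebraic_gt (p1 - p2)); congr semialgebraic.
  by apply/seteqP; split=> x /=;
    rewrite mpoly.mevalB -E1 -E2 subr_gt0 leNgt => /negP.
- move=> f IHf g IHg /andP[qf qg] /andP[rf rg].
  have := semialgebraicI (IHf qf rf) (IHg qg rg); congr semialgebraic.
  by apply/seteqP; split=> x /= /andP.
- move=> f IHf g IHg /andP[qf qg] /andP[rf rg].
  have := semialgebraicU (IHf qf rf) (IHg qg rg); congr semialgebraic.
  by apply/seteqP; split=> x /= /orP.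
- move=> f IHf g IHg /andP[qf qg] /andP[rf rg].
  have := semialgebraicU (semialgebraicC (IHf qf rf)) (IHg qg rg).
  congr semialgebraic; apply/seteqP; split=> x /=; rewrite implybE.
    by move=> [/negP->|->]; rewrite ?orbT.
  by move=> /orP[/negP|]; [left|right].
- move=> f IHf qf rf; have := semialgebraicC (IHf qf rf).
  by congr semialgebraic; apply/seteqP; split=> x /= /negP.
Qed.

Lemma semialgebraic_proj n (S : set 'rV[R]_(n + 1)) : semialgebraic S ->
  semialgebraic [set x : 'rV[R]_n | exists t : R,
    S (row_mx x (const_mx t : 'rV[R]_1))].
Proof.
move=> /formula_of_semialgebraic[f hf].
pose g := quantifier_elim
  (fun i oc => qe_rcf.qfr_to_formula (@qe_rcf.wproj R i oc)) (to_rform (Exists n f)).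
have /andP[qg rg] : qf_form g && rformula g.
  by apply: (quantifier_elim_wf (@qe_rcf.wf_QE_wproj R));
     exact: to_rform_rformula.
have := @semialgebraic_qf n g qg rg; congr semialgebraic.
have envE (x : 'rV[R]_n) t : GRing.same_env
    (env (row_mx x (const_mx t : 'rV[R]_1))) (set_nth 0 (env x) n t).
  move=> k; rewrite nth_set_nth /=; case: ltngtP => kn.
  - rewrite -[k]/(val (lshift 1 (Ordinal kn))) nth_env row_mxEl.
    by rewrite -nth_env.
  - by rewrite nth_env_ge ?addn1 // nth_env_ge // ltnW.
  - have -> : k = rshift n (0 : 'I_1) by rewrite /= addn0.
    by rewrite nth_env row_mxEr mxE.
apply/seteqP; split=> x /=.
- move=> /(qe_rcf.rcf_satP (env x) (Exists n f))[t h]; exists t; apply/hf.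
  by apply: eq_holds h => k; rewrite envE.
- move=> [t /hf h]; apply/(qe_rcf.rcf_satP (env x) (Exists n f)) => /=.
  by exists t; exact: eq_holds h.
Qed.

End Tarski_Seidenberg.

Section closure.
Variables (R : realType) (m : nat) (M : set 'rV[R]_m).
Hypothesis hM : semialgebraic M.

Let gr (f : M -> R) := map_graph (fun x => const_mx (f x) : 'rV[R]_1).

Let grE f (z : 'rV[R]_m) (y : R) :
  gr f (row_mx z (const_mx y : 'rV[R]_1)) <-> exists x : M, z = \val x /\ y = f x.
Proof.
split=> [[x /eq_row_mx[-> /matrixP/(_ 0 0)]]|[x [-> ->]]].
  by rewrite !mxE => ->; exists x.
by exists x.
Qed.

Let rowE (z : 'rV[R]_(m + 1)) :
  z = row_mx (lsubmx z) (const_mx (z 0 (rshift m 0)) : 'rV[R]_1).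
Proof.
rewrite -[LHS]hsubmxK; congr row_mx; apply/rowP => i.
by rewrite !mxE (ord1 i).
Qed.

Let X k (i : 'I_k) : mpoly.mpoly k R := mpoly.mpolyX R (mpoly.mnm1 i).

(* In coordinates (z, y, u, v) with z in R^m. *)
Let gr_op (P : mpoly.mpoly (m + 1 + 1 + 1) R) (h : R -> R -> R) (f g : M -> R) :
  (forall (w : 'rV[R]_(m + 1)) u v,
    mpoly.meval (row_mx (row_mx w (const_mx u : 'rV[R]_1))
                        (const_mx v : 'rV[R]_1) 0) P = h u v) ->
  semialgebraic (gr f) -> semialgebraic (gr g) ->
  semialgebraic (gr (fun x => h (f x) (g x))).
Proof.
move=> hP sf sg; pose k := (m + 1 + 1 + 1)%N.
pose zy : 'I_(m + 1) -> 'I_k := fun i => lshift 1 (lshift 1 i).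
pose iu : 'I_k := lshift 1 (rshift (m + 1) (0 : 'I_1)).
pose iv : 'I_k := rshift (m + 1 + 1) (0 : 'I_1).
pose q (j : 'I_k) (i : 'I_(m + 1)) : mpoly.mpoly k R :=
  match fintype.split i with inl i' => X (zy (lshift 1 i')) | inr _ => X j end.
pose pt (w : 'rV[R]_(m + 1)) u v : 'rV[R]_k :=
  row_mx (row_mx w (const_mx u : 'rV[R]_1)) (const_mx v : 'rV[R]_1).
have qE j w u v : \row_i mpoly.meval (pt w u v 0) (q j i) =
    row_mx (lsubmx w) (const_mx (pt w u v 0 j) : 'rV[R]_1).
  apply/rowP => i; rewrite !mxE /q; case: fintype.split => i'.
    by rewrite mpoly.mevalXU /pt /zy !row_mxEl mxE.
  by rewrite mpoly.mevalXU !mxE.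
have ptu w u v : pt w u v 0 iu = u by rewrite /pt row_mxEl row_mxEr mxE.
have ptv w u v : pt w u v 0 iv = v by rewrite /pt row_mxEr mxE.
pose y : 'I_k := zy (rshift m (0 : 'I_1)).
have pty w u v : pt w u v 0 y = w 0 (rshift m 0) by rewrite /pt !row_mxEl.
have S1 := semialgebraic_preimage (q iu) sf.
have S2 := semialgebraic_preimage (q iv) sg.
have := semialgebraicI (semialgebraicI S1 S2) (semialgebraic_eq (X y - P)).
move=> /semialgebraic_proj /semialgebraic_proj.
congr semialgebraic; apply/seteqP; split=> w.
- move=> /= [u [v]]; rewrite -/(pt w u v) !qE ptu ptv mpoly.mevalB hP.
  rewrite mpoly.mevalXU pty => -[[/grE[x [zx ->]] /grE[x' [zx' ->]]]].
  have <- : x = x' by apply: val_inj; rewrite -zx -zx'.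
  by move=> /subr0_eq wE; rewrite [w]rowE; apply/grE; exists x.
- rewrite [w]rowE => /grE[x [zx wy]]; rewrite -rowE /=.
  exists (f x), (g x); rewrite -/(pt w (f x) (g x)) !qE ptu ptv mpoly.mevalB hP.
  rewrite mpoly.mevalXU pty wy subrr zx.
  by split=> //; split; apply/grE; exists x.
Qed.

Let gr1 : semialgebraic (gr (fun=> 1)).
Proof.
pose q (i : 'I_m) : mpoly.mpoly (m + 1) R := X (lshift 1 i).
have qE (w : 'rV[R]_(m + 1)) : \row_i mpoly.meval (w 0) (q i) = lsubmx w.
  by apply/rowP => i; rewrite !mxE mpoly.mevalXU.
have := semialgebraicI (semialgebraic_preimage q hM)
  (semialgebraic_eq (X (rshift m (0 : 'I_1)) - 1)).
congr semialgebraic; apply/seteqP; split=> w /=.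
- rewrite qE mpoly.mevalB mpoly.meval1 mpoly.mevalXU => -[Mw /subr0_eq w1].
  by rewrite [w]rowE; apply/grE; exists (SigSub (mem_set Mw)).
- rewrite [w]rowE => /grE[x [zx wy]]; rewrite -rowE qE zx.
  rewrite mpoly.mevalB mpoly.meval1 mpoly.mevalXU wy subrr.
  by split=> //; exact: set_mem (valP x).
Qed.

Lemma bounded_semialgebraic_subring_closed :
  subring_closed (@bounded_semialgebraic R m M).
Proof.
pose iu := lshift 1 (rshift (m + 1) (0 : 'I_1)).
pose iv := rshift (m + 1 + 1) (0 : 'I_1).
have bndE (f : M -> R) :
    bounded_fun f <-> exists C : R, forall x, `|f x| <= C.
  split=> [[C [_ h]]|[C h]].
    by exists (C + 1) => x; apply: h => //; rewrite ltrDl.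
  exists C; split; first exact: num_real.
  by move=> D CD x _; exact: le_trans (h x) (ltW CD).
split.
- apply/asboolP; split; first exact: (@cst_continuous M R 1).
    exact: gr1.
  by apply/bndE; exists 1 => x; rewrite normr1.
- move=> f g /asboolP[cf sf /bndE[C hC]] /asboolP[cg sg /bndE[D hD]].
  apply/asboolP; split.
  + by move=> x; exact: cvgB (cf x) (cg x).
  + apply: (@gr_op (X iu - X iv) (fun u v => u - v)) sf sg => w u v.
    by rewrite mpoly.mevalB !mpoly.mevalXU row_mxEl !row_mxEr !mxE.
  + apply/bndE; exists (C + D) => x.
    exact: le_trans (ler_normB _ _) (lerD (hC x) (hD x)).
- move=> f g /asboolP[cf sf /bndE[C hC]] /asboolP[cg sg /bndE[D hD]].
  apply/asboolP; split.
  + by move=> x; exact: cvgM (cf x) (cg x).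
  + apply: (@gr_op (X iu * X iv) (fun u v => u * v)) sf sg => w u v.
    by rewrite mpoly.mevalM !mpoly.mevalXU row_mxEl !row_mxEr !mxE.
  + apply/bndE; exists (C * D) => x.
    by rewrite normrM; apply: ler_pM.
Qed.

End closure.

(* The ring S*(M). The hypothesis on M is what makes the constant functions
   semialgebraic, so that S*(M) is a unital subring of the functions M -> R.  *)
Record Sstar (R : realType) (m : nat) (M : set 'rV[R]_m)
    (hM : semialgebraic M) : Type := MkSstar {
  Sstar_val :> M -> R;
  SstarP : Sstar_val \in @bounded_semialgebraic R m M }.

Section Sstar_ring.
Variables (R : realType) (m : nat) (M : set 'rV[R]_m) (hM : semialgebraic M).

HB.instance Definition _ := [isSub for @Sstar_val R m M hM].
HB.instance Definition _ := [Choice of Sstar hM by <:].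
HB.instance Definition _ :=
  @GRing.SubChoice_isSubComPzRing.Build (M -> R) (@bounded_semialgebraic R m M)
    (Sstar hM) (bounded_semialgebraic_subring_closed hM).

End Sstar_ring.

(* Main.v *)
Require Import Defs.
From HB Require Import structures.
From mathcomp Require Import all_boot all_order all_algebra.
From mathcomp Require Import all_classical all_reals topology normedtype.
From mathcomp Require Import sequences.
From mathcomp Require mpoly polyrcf.
From mathcomp Require Import ring lra.

Set Implicit Arguments.
Unset Strict Implicit.
Unset Printing Implicit Defensive.

Import Order.TTheory GRing.Theory Num.Theory.
Import numFieldNormedType.Exports.
Import (canonicals) mpoly.

Local Open Scope classical_set_scope.
Local Open Scope ring_scope.

(** The idea is to recognise, inside the ring S*(M), the points of M other than
   its end points.

   An isomorphism phi : S*(N) -> S*(M) turns the evaluation at z in M into a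
   character of S*(N), that is a unital ring map S*(N) -> R. Characters fix the
   real constants (real_endomorphism_id) and are limits of evaluations
   (character_dense), since a function bounded away from 0 is a unit. Either the
   character is the evaluation at some x in N, and z corresponds to x, or it is
   a point at infinity of N. In the second case the function f on N that comes
   from the distance to z is positive on N, and every element of S*(N) has a
   limit as f tends to 0. If the small level sets of f had two points, an element
   of S*(N) could be rescaled on each level set so as to oscillate between 0 and
   1, and would have no limit (constant_on_fibers). So the small level sets of f
   are single points, these points form an arc, and the arc is carried back to M:
   close to z, the set M is an arc that starts at z, and z belongs to eta(M)
   (not_corresponds_metric_end). Moreover corresponding points are end points
   simultaneously (corresponds_metric_end). Hence the points of M \ eta(M) and
   N \ eta(N) correspond bijectively. The bijection is continuous because the
   distance functions belong to the rings, and its graph is semialgebraic because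
   finitely many elements of the ring separate the points
   (homeomorphic_of_isomorphism).

   Conversely, a bounded semialgebraic function on M \ eta(M) extends uniquely to
   M (admissible_extension): along the arc at an end point it is a bounded
   semialgebraic function of one variable, which has a limit. A semialgebraic
   homeomorphism between M \ eta(M) and N \ eta(N) thus induces an isomorphism
   between S*(N) and S*(M) (isomorphism_of_homeomorphic).

   Two tools support this. Semialgebraic sets are closed under first-order
   definitions, and a semialgebraic set of reals contains or avoids a right
   neighbourhood of each point (definable_at_right), from which follow limits,
   continuity and monotonicity of semialgebraic functions of one variable near 0.
   To make eta(M) itself definable it is described by distances (metric_end):
   y is in eta(M) when each small sphere around y meets M exactly once. *)

(** * Semialgebraic sets and first-order definitions *)
Section Reindexing.
Variable R : realType.

Lemma semialgebraic_reindex m n (s : 'I_n -> 'I_m) (S : set 'rV[R]_n) :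
  semialgebraic S -> semialgebraic [set x : 'rV[R]_m | S (\row_i x 0 (s i))].
Proof.
move=> /(semialgebraic_preimage (fun i => mpoly.mpolyX R (mpoly.mnm1 (s i)))).
congr semialgebraic; apply/seteqP; split=> x /=;
  by congr S; apply/rowP => i; rewrite !mxE mpoly.mevalXU.
Qed.

(** Projects one coordinate at a time. The coordinate that is removed must come
   last, so the block m + n.+1 is reassociated as (m + 1) + n. *)
Lemma semialgebraic_exists m n (S : set 'rV[R]_(m + n)) : semialgebraic S ->
  semialgebraic [set x : 'rV[R]_m | exists y : 'rV[R]_n, S (row_mx x y)].
Proof.
elim: n m S => [|n IHn] m S hS.
  have := semialgebraic_reindex (cast_ord (addn0 m)) hS.
  congr semialgebraic; apply/seteqP; split=> x /=.
    move=> Sx; exists 0; congr S: Sx; apply/rowP => i; rewrite !mxE.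
    case: splitP => j E; last by case: j E.
    by congr (x 0 _); apply: val_inj.
  move=> [y]; congr S; apply/rowP => i; rewrite !mxE.
  case: splitP => j E; last by case: j E.
  by congr (x 0 _); apply: val_inj.
have e : (m + n.+1 = m + 1 + n)%N by rewrite addn1 addSnnS.
have := IHn (m + 1)%N _ (semialgebraic_reindex (cast_ord e) hS).
move=> /semialgebraic_proj; congr semialgebraic.
have rowE (x : 'rV[R]_m) t (y : 'rV[R]_n) :
    \row_i row_mx (row_mx x (const_mx t : 'rV[R]_1)) y 0 (cast_ord e i) =
    row_mx x (row_mx (const_mx t : 'rV[R]_1) y : 'rV[R]_n.+1).
  apply/rowP => i; rewrite mxE.
  case: (split_ordP i) => j ->.
    rewrite (_ : cast_ord e _ = lshift n (lshift 1 j)); last exact: val_inj.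
    by rewrite !row_mxEl.
  rewrite row_mxEr; case: (@split_ordP 1 n j) => k ->.
    rewrite (_ : cast_ord e _ = lshift n (rshift m k)); last exact: val_inj.
    by rewrite !row_mxEl row_mxEr; exact/esym/(@row_mxEl _ 1 1 n).
  rewrite (_ : cast_ord e _ = rshift (m + 1) k); last first.
    by apply: val_inj; rewrite /= addnA.
  by rewrite row_mxEr; exact/esym/(@row_mxEr _ 1 1 n).
apply/seteqP; split=> x /=.
  by move=> [t [y]]; rewrite rowE => ?;
    exists (row_mx (const_mx t : 'rV[R]_1) y : 'rV[R]_n.+1).
move=> [y Sy]; exists (y 0 ord0), (@rsubmx _ _ 1 n y); rewrite rowE.
suff -> : row_mx (const_mx (y 0 ord0) : 'rV[R]_1) (@rsubmx _ _ 1 n y) = y by [].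
rewrite -[RHS](@hsubmxK _ _ 1 n); congr (@row_mx _ 1 1 n _ _).
apply/rowP => i; rewrite !mxE (ord1 i); congr (y 0 _); exact: val_inj.
Qed.

End Reindexing.

(** Identifies a type with some R^k, so that formulas may have free variables in
   products of R and of spaces of row vectors. *)
Class coordinates (R : realType) (X : Type) := Coordinates {
  cdim : nat;
  enc : X -> 'rV[R]_cdim;
  dec : 'rV[R]_cdim -> X;
  encK : cancel enc dec;
  decK : cancel dec enc }.

#[export] Hint Mode coordinates - ! : typeclass_instances.

Section Instances.
Variable R : realType.

#[export, refine] Instance coordinates_rV n : coordinates R 'rV[R]_n :=
  {| enc := id; dec := id |}.
Proof. all: by []. Defined.

#[export, refine] Instance coordinates_R : coordinates R R :=
  {| enc := fun t => const_mx t : 'rV[R]_1; dec := fun v => v 0 0 |}.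
Proof.
- by move=> t; rewrite mxE.
- by move=> v; apply/rowP => i; rewrite mxE ord1.
Defined.

#[export, refine] Instance coordinates_prod X Y
    (cX : coordinates R X) (cY : coordinates R Y) : coordinates R (X * Y) :=
  {| enc := fun p => row_mx (enc p.1) (enc p.2);
     dec := fun v => (dec (lsubmx v), dec (rsubmx v)) |}.
Proof.
- by move=> [x y]; rewrite row_mxKl row_mxKr !encK.
- by move=> v; rewrite /= !decK hsubmxK.
Defined.
End Instances.

Definition definable (R : realType) X (cX : coordinates R X) (P : X -> Prop) :=
  semialgebraic [set v | P (dec v)].
Arguments definable R {X cX} P.

Definition definable_fun (R : realType) X Y (cX : coordinates R X)
  (cY : coordinates R Y) (f : X -> Y) := @definable R _ _ (fun p : X * Y => f p.1 = p.2).
Arguments definable_fun R {X Y cX cY} f.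

Section Definable.
Variable R : realType.
Context {X Y Z : Type} {cX : coordinates R X} {cY : coordinates R Y}
  {cZ : coordinates R Z}.

Lemma definable_ext (P Q : X -> Prop) :
  definable R P -> (forall x, P x <-> Q x) -> definable R Q.
Proof.
by move=> dP PQ; rewrite (_ : Q = P)//; apply/funext => x; apply/propext; rewrite PQ.
Qed.

Lemma definable_and (P Q : X -> Prop) :
  definable R P -> definable R Q -> definable R (fun x => P x /\ Q x).
Proof. exact: semialgebraicI. Qed.

Lemma definable_or (P Q : X -> Prop) :
  definable R P -> definable R Q -> definable R (fun x => P x \/ Q x).
Proof. exact: semialgebraicU. Qed.

Lemma definable_not (P : X -> Prop) :
  definable R P -> definable R (fun x => ~ P x).
Proof. exact: semialgebraicC. Qed.

Lemma definable_imp (P Q : X -> Prop) :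
  definable R P -> definable R Q -> definable R (fun x => P x -> Q x).
Proof.
move=> dP dQ; apply: (definable_ext (definable_or (definable_not dP) dQ)) => x.
by split=> [[]//|PQ]; case: (pselect (P x)) => ?; [right; apply: PQ|left].
Qed.

Lemma definable_const (P : Prop) : definable R (fun _ : X => P).
Proof.
have := semialgebraic_bool R (@cdim R X cX) `[< P >]; congr semialgebraic.
by apply/seteqP; split=> x /= /asboolP.
Qed.

Lemma definable_exists (P : X -> Y -> Prop) :
  definable R (fun p : X * Y => P p.1 p.2) -> definable R (fun x => exists y, P x y).
Proof.
move=> /semialgebraic_exists; congr semialgebraic; apply/seteqP; split=> x /=.
  by move=> [y]; rewrite row_mxKl row_mxKr; exists (dec y).
by move=> [y Py]; exists (enc y); rewrite row_mxKl row_mxKr encK.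
Qed.

Lemma definable_forall_ord n (P : 'I_n -> X -> Prop) :
  (forall i, definable R (P i)) -> definable R (fun x => forall i, P i x).
Proof.
move=> dP.
suff H : forall s : seq 'I_n, @definable R X cX (fun x => forall i, i \in s -> P i x).
  apply: (definable_ext (H (enum 'I_n))) => x.
  by split=> Px i; [apply: Px; rewrite mem_enum|move=> _].
elim=> [|j s IHs].
  by apply: (definable_ext (definable_const True)) => x; split=> // _ i.
apply: (definable_ext (definable_and (dP j) IHs)) => x; split=> [[Pj Ps] i|Ps].
  by rewrite inE => /orP[/eqP ->//|]; exact: Ps.
split; first by apply: Ps; rewrite inE eqxx.
by move=> i si; apply: Ps; rewrite inE si orbT.
Qed.
End Definable.

Section Universal.
Variable R : realType.
Context {X Y Z T : Type} {cX : coordinates R X} {cY : coordinates R Y}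
  {cZ : coordinates R Z} {cT : coordinates R T}.

Lemma definable_forall (P : X -> Y -> Prop) :
  definable R (fun p : X * Y => P p.1 p.2) -> definable R (fun x => forall y, P x y).
Proof.
move=> /definable_not /(@definable_exists _ _ _ _ _ (fun x y => ~ P x y)).
move=> /definable_not /definable_ext; apply => x.
by split=> [H y|H [y]//]; apply: contrapT => ?; apply: H; exists y.
Qed.

End Universal.

(** Substitution of polynomials preserves semialgebraic sets directly; it serves to
   permute and duplicate variables before definable maps can be substituted. *)
Definition polynomial_map (R : realType) X Y (cX : coordinates R X) (cY : coordinates R Y)
    (f : X -> Y) :=
  exists q : 'I_(@cdim _ _ cY) -> mpoly.mpoly (@cdim _ _ cX) R,
    forall x, enc (f x) = \row_i mpoly.meval (enc x 0) (q i).
Arguments polynomial_map R {X Y cX cY} f.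

Section PolynomialMaps.
Variable R : realType.

Context {X Y Z : Type} {cX : coordinates R X} {cY : coordinates R Y}
  {cZ : coordinates R Z}.

Lemma polynomial_map_fst : polynomial_map R (@fst X Y).
Proof.
exists (fun i => mpoly.mpolyX R (mpoly.mnm1 (lshift _ i))) => x.
by apply/rowP => i; rewrite !mxE mpoly.mevalXU row_mxEl.
Qed.

Lemma polynomial_map_snd : polynomial_map R (@snd X Y).
Proof.
exists (fun i => mpoly.mpolyX R (mpoly.mnm1 (rshift _ i))) => x.
by apply/rowP => i; rewrite !mxE mpoly.mevalXU row_mxEr.
Qed.

Lemma polynomial_map_id : polynomial_map R (@id X).
Proof.
exists (fun i => mpoly.mpolyX R (mpoly.mnm1 i)) => x.
by apply/rowP => i; rewrite !mxE mpoly.mevalXU.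
Qed.

Lemma polynomial_map_pair (f : X -> Y) (g : X -> Z) :
  polynomial_map R f -> polynomial_map R g -> polynomial_map R (fun x => (f x, g x)).
Proof.
move=> [p fE] [q gE].
exists (fun i => match fintype.split i with inl j => p j | inr j => q j end) => x.
apply/rowP => i; rewrite !mxE; case: splitP => j _.
  by rewrite /= fE !mxE.
by rewrite /= gE !mxE.
Qed.

Lemma polynomial_map_comp (f : X -> Y) (g : Y -> Z) :
  polynomial_map R f -> polynomial_map R g -> polynomial_map R (fun x => g (f x)).
Proof.
move=> [p fE] [q gE].
exists (fun i => mpoly.comp_mpoly [tuple p j | j < _] (q i)) => x.
apply/rowP => i; rewrite gE !mxE mpoly.comp_mpoly_meval; apply: mpoly.meval_eq => j.
by rewrite fE mxE tnth_mktuple.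
Qed.

Lemma definable_polynomial (f : X -> Y) (P : Y -> Prop) :
  polynomial_map R f -> definable R P -> definable R (fun x => P (f x)).
Proof.
move=> [q fE] /(semialgebraic_preimage q); congr semialgebraic.
have E (v : 'rV[R]_(@cdim _ _ cX)) :
    @dec _ _ cY (\row_i mpoly.meval (v 0) (q i)) = f (dec v).
  by rewrite -[RHS]encK fE decK.
by apply/seteqP; split=> v /=; rewrite E.
Qed.

Lemma definable_fun_polynomial (f : X -> Y) : polynomial_map R f -> definable_fun R f.
Proof.
move=> [q fE].
have : definable R (fun p : X * Y => forall i,
    mpoly.meval (enc p.1 0) (q i) = enc p.2 0 i).
  apply: definable_forall_ord => i.
  pose l := mpoly.comp_mpoly
    [tuple mpoly.mpolyX R (mpoly.mnm1 (lshift (@cdim _ _ cY) j)) | j < _] (q i).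
  have := semialgebraic_eq (l - mpoly.mpolyX R (mpoly.mnm1 (rshift _ i))).
  congr semialgebraic; apply/seteqP.
  have lE (v : 'rV_(@cdim _ _ cX + @cdim _ _ cY)) :
      mpoly.meval (v 0) l = mpoly.meval (lsubmx v 0) (q i).
    rewrite mpoly.comp_mpoly_meval; apply: mpoly.meval_eq => j.
    by rewrite tnth_mktuple mpoly.mevalXU mxE.
  split=> v /=; rewrite mpoly.mevalB mpoly.mevalXU lE !decK mxE.
    exact: subr0_eq.
  by move=> ->; rewrite subrr.
move=> /definable_ext; apply => -[x y] /=; split=> [H|<- i]; last by rewrite fE mxE.
by apply: (can_inj encK); rewrite fE; apply/rowP => i; rewrite mxE H.
Qed.
End PolynomialMaps.
Arguments polynomial_map_fst {R X Y cX cY}.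
Arguments polynomial_map_snd {R X Y cX cY}.
Arguments polynomial_map_id {R X cX}.

Section Composition.
Variable R : realType.
Context {X Y Z : Type} {cX : coordinates R X} {cY : coordinates R Y}
  {cZ : coordinates R Z}.

(** The formula P (f x) is equivalent to: some y satisfies f x = y and P y. *)
Lemma definable_comp (f : X -> Y) (P : Y -> Prop) :
  definable R P -> definable_fun R f -> definable R (fun x => P (f x)).
Proof.
move=> dP df.
have dyf : definable R (fun p : X * Y => f p.1 = p.2 /\ P p.2).
  apply: definable_and df _.
  exact: (definable_polynomial polynomial_map_snd dP).
have := definable_exists (P := fun x y => f x = y /\ P y) dyf.
by move=> /definable_ext; apply => x; split=> [[y [<-]]//|Pf]; exists (f x).
Qed.

Lemma definable_fun_id : definable_fun R (fun x : X => x).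
Proof. exact/definable_fun_polynomial/polynomial_map_id. Qed.

Lemma definable_fun_cst (y : Y) : definable_fun R (fun _ : X => y).
Proof.
apply: definable_fun_polynomial.
exists (fun i => mpoly.mpolyC _ (enc y 0 i)) => x.
by apply/rowP => i; rewrite mxE mpoly.mevalC.
Qed.

Lemma definable_fun_pair (f : X -> Y) (g : X -> Z) :
  definable_fun R f -> definable_fun R g -> definable_fun R (fun x => (f x, g x)).
Proof.
move=> df dg.
have H1 : polynomial_map R (fun p : X * (Y * Z) => (p.1, p.2.1)).
  apply: polynomial_map_pair; first exact polynomial_map_fst.
  exact: (polynomial_map_comp polynomial_map_snd polynomial_map_fst).
have H2 : polynomial_map R (fun p : X * (Y * Z) => (p.1, p.2.2)).
  apply: polynomial_map_pair; first exact polynomial_map_fst.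
  exact: (polynomial_map_comp polynomial_map_snd polynomial_map_snd).
apply: (definable_ext (definable_and (definable_polynomial H1 df)
  (definable_polynomial H2 dg))) => -[x [y z]] /=.
by split=> [[-> ->]|[-> ->]].
Qed.

End Composition.

Section MapComposition.
Variable R : realType.
Context {X Y Z : Type} {cX : coordinates R X} {cY : coordinates R Y}
  {cZ : coordinates R Z}.

Lemma definable_fun_comp (f : X -> Y) (g : Y -> Z) :
  definable_fun R g -> definable_fun R f -> definable_fun R (fun x => g (f x)).
Proof.
move=> dg df.
have q : polynomial_map R (fun p : X * Z * Y => (p.1.1, p.2)).
  apply: polynomial_map_pair; last exact polynomial_map_snd.
  exact: (polynomial_map_comp polynomial_map_fst polynomial_map_fst).
have d1 : definable_fun R (fun p : X * Z => f p.1).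
  exact: (definable_polynomial q df).
have d2 : definable_fun R (fun p : X * Z => p.2).
  exact: (definable_fun_polynomial polynomial_map_snd).
exact: definable_comp dg (definable_fun_pair d1 d2).
Qed.

End MapComposition.

Section Atoms.
Variable R : realType.
Context {X Y Z : Type} {cX : coordinates R X} {cY : coordinates R Y}
  {cZ : coordinates R Z}.

Lemma definable_fun_fst (f : X -> Y * Z) :
  definable_fun R f -> definable_fun R (fun x => (f x).1).
Proof.
apply: definable_fun_comp; exact: (definable_fun_polynomial polynomial_map_fst).
Qed.

Lemma definable_fun_snd (f : X -> Y * Z) :
  definable_fun R f -> definable_fun R (fun x => (f x).2).
Proof.
apply: definable_fun_comp; exact: (definable_fun_polynomial polynomial_map_snd).
Qed.

Lemma definable_eq (f g : X -> Y) :
  definable_fun R f -> definable_fun R g -> definable R (fun x => f x = g x).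
Proof.
move=> df dg.
exact: (definable_comp (@definable_fun_id R Y cY) (definable_fun_pair df dg)).
Qed.

Lemma definable_fun_coord n (f : X -> 'rV[R]_n) (i : 'I_n) :
  definable_fun R f -> definable_fun R (fun x => f x 0 i).
Proof.
apply: (definable_fun_comp (g := fun v : 'rV[R]_n => v 0 i)).
apply: definable_fun_polynomial.
exists (fun _ => mpoly.mpolyX R (mpoly.mnm1 i)) => x.
by apply/rowP => j; rewrite !mxE mpoly.mevalXU.
Qed.

Lemma definable_fun_const_mx (f : X -> R) :
  definable_fun R f -> definable_fun R (fun x => const_mx (f x) : 'rV[R]_1).
Proof.
apply: (definable_fun_comp (g := fun t : R => const_mx t : 'rV[R]_1)).
apply: definable_fun_polynomial.
exists (fun i => mpoly.mpolyX R (mpoly.mnm1 i)) => t.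
by apply/rowP => i; rewrite !mxE mpoly.mevalXU mxE.
Qed.

Lemma definable_lt (f g : X -> R) :
  definable_fun R f -> definable_fun R g -> definable R (fun x => f x < g x).
Proof.
move=> df dg; apply: (@definable_comp _ _ _ _ _ (fun x => (f x, g x))
  (fun p : R * R => p.1 < p.2)); last exact: definable_fun_pair.
have := semialgebraic_gt (mpoly.mpolyX R (mpoly.mnm1 (1%R : 'I_2)) -
   mpoly.mpolyX R (mpoly.mnm1 (0 : 'I_2))).
congr semialgebraic; apply/seteqP; split=> v /=;
rewrite mpoly.mevalB !mpoly.mevalXU subr_gt0 !mxE;
  by congr (v 0 _ < v 0 _); apply: val_inj.
Qed.

Lemma definable_le (f g : X -> R) :
  definable_fun R f -> definable_fun R g -> definable R (fun x => f x <= g x).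
Proof.
move=> df dg; apply: (definable_ext (definable_not (definable_lt dg df))) => x.
by rewrite leNgt; split=> /negP.
Qed.

Lemma definable_fun_op2 (h : R -> R -> R) (f g : X -> R)
    (q : mpoly.mpoly (1 + 1) R) :
  (forall v : 'rV[R]_(1 + 1),
    mpoly.meval (v 0) q = h (v 0 (lshift 1 0)) (v 0 (rshift 1 0))) ->
  definable_fun R f -> definable_fun R g -> definable_fun R (fun x => h (f x) (g x)).
Proof.
move=> qE df dg; apply: (definable_fun_comp (f := fun x => (f x, g x))
  (g := fun p : R * R => h p.1 p.2)); last exact: definable_fun_pair.
apply: definable_fun_polynomial; exists (fun=> q) => -[a b] /=.
by apply/rowP => i; rewrite !mxE qE row_mxEl row_mxEr !mxE.
Qed.

Lemma definable_fun_add (f g : X -> R) :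
  definable_fun R f -> definable_fun R g -> definable_fun R (fun x => f x + g x).
Proof.
apply: (definable_fun_op2 (q := mpoly.mpolyX R (mpoly.mnm1 (lshift 1 0)) +
  mpoly.mpolyX R (mpoly.mnm1 (rshift 1 0)))) => v.
by rewrite mpoly.mevalD !mpoly.mevalXU.
Qed.

Lemma definable_fun_mul (f g : X -> R) :
  definable_fun R f -> definable_fun R g -> definable_fun R (fun x => f x * g x).
Proof.
apply: (definable_fun_op2 (q := mpoly.mpolyX R (mpoly.mnm1 (lshift 1 0)) *
  mpoly.mpolyX R (mpoly.mnm1 (rshift 1 0)))) => v.
by rewrite mpoly.mevalM !mpoly.mevalXU.
Qed.

Lemma definable_fun_opp (f : X -> R) :
  definable_fun R f -> definable_fun R (fun x => - f x).
Proof.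
move=> df.
apply: (definable_fun_op2 (h := fun a _ => - a)
  (q := - mpoly.mpolyX R (mpoly.mnm1 (lshift 1 0))) _ df df) => v.
by rewrite mpoly.mevalN !mpoly.mevalXU.
Qed.

Lemma definable_fun_vecB n (f g : X -> 'rV[R]_n) :
  definable_fun R f -> definable_fun R g -> definable_fun R (fun x => f x - g x).
Proof.
move=> df dg; apply: (definable_fun_comp (f := fun x => (f x, g x))
  (g := fun p : 'rV[R]_n * 'rV[R]_n => p.1 - p.2)); last exact: definable_fun_pair.
apply: definable_fun_polynomial.
exists (fun i => mpoly.mpolyX R (mpoly.mnm1 (lshift n i)) -
  mpoly.mpolyX R (mpoly.mnm1 (rshift n i))) => -[a b] /=.
by apply/rowP => i; rewrite !mxE mpoly.mevalB !mpoly.mevalXU row_mxEl row_mxEr.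
Qed.
End Atoms.

Section Conditionals.
Variable R : realType.
Context {X Y : Type} {cX : coordinates R X} {cY : coordinates R Y}.

Lemma definable_andb (a b : X -> bool) :
  definable R (fun x => a x) -> definable R (fun x => b x) ->
  definable R (fun x => a x && b x).
Proof.
move=> da db; have := definable_and da db.
by move=> /definable_ext; apply=> x; split=> /andP.
Qed.

Lemma definable_fun_if (b : X -> bool) (f g : X -> Y) :
  definable R (fun x => b x) -> definable_fun R f -> definable_fun R g ->
  definable_fun R (fun x => if b x then f x else g x).
Proof.
move=> db df dg.
have d1 : definable R (fun p : X * Y => b p.1).
  exact: (definable_polynomial polynomial_map_fst db).
have := definable_or (definable_and d1 df) (definable_and (definable_not d1) dg).
move=> /definable_ext; apply=> -[x y] /=.
by case: (b x); split=> [|E]; [case=> [[]|[/(_ isT)]]|left|case=> [[]|[]]|right].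
Qed.

Lemma definable_fun_inv (f : X -> R) :
  definable_fun R f -> definable_fun R (fun x => (f x)^-1).
Proof.
apply: definable_fun_comp.
have d1 : definable_fun R (fun p : R * R => p.1).
  exact: (definable_fun_polynomial polynomial_map_fst).
have d2 : definable_fun R (fun p : R * R => p.2).
  exact: (definable_fun_polynomial polynomial_map_snd).
have d0 : definable_fun R (fun p : R * R => 0 : R).
  exact: (definable_fun_cst _).
have e0 : definable_fun R (fun p : R * R => 1 : R).
  exact: (definable_fun_cst _).
apply: (definable_ext (definable_or (definable_and (definable_eq d1 d0)
  (definable_eq d2 d0)) (definable_eq (definable_fun_mul d1 d2) e0))) => -[a b] /=.
split=> [[[-> ->]|ab1]|<-]; first by rewrite invr0.
  have a0 : a != 0 by apply/eqP => a0; move/eqP: ab1; rewrite a0 mul0r eq_sym oner_eq0.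
  by rewrite -[LHS]mulr1 -ab1 mulKf.
by have [->|a0] := eqVneq a 0; [left; rewrite invr0|right; rewrite mulfV].
Qed.
End Conditionals.

Section Norms.
Variable R : realType.
Context {X : Type} {cX : coordinates R X}.

Lemma definable_fun_norm (f : X -> R) :
  definable_fun R f -> definable_fun R (fun x => `|f x|).
Proof.
move=> df; rewrite (_ : (fun x => _) = fun x => if 0 <= f x then f x else - f x).
  apply: definable_fun_if => //; last exact: definable_fun_opp.
  by apply: definable_le => //; exact: definable_fun_cst.
by apply/funext => x; case: ger0P.
Qed.

Lemma definable_fun_min (f g : X -> R) :
  definable_fun R f -> definable_fun R g -> definable_fun R (fun x => Num.min (f x) (g x)).
Proof. by move=> df dg; apply: definable_fun_if => //; exact: definable_lt. Qed.

End Norms.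

Section VectorNorms.
Variable R : realType.
Context {X : Type} {cX : coordinates R X}.

Lemma ler_rowP n (v : 'rV[R]_n) (r : R) :
  `|v| <= r <-> 0 <= r /\ forall i, `|v 0 i| <= r.
Proof.
rewrite /Num.norm/= mx_normrE; split=> [vr|[r0 vr]].
  split=> [|i].
    by apply: le_trans vr; elim/big_ind: _ => // a b a0 b0; rewrite le_max a0.
  by apply: le_trans vr; exact: (le_bigmax _ (fun ij : 'I_1 * 'I_n => `|v ij.1 ij.2|) (0, i)).
by apply/bigmax_leP; split=> // -[i j] _ /=; rewrite ord1; exact: vr.
Qed.

Lemma definable_fun_vecnorm n (f : X -> 'rV[R]_n) :
  definable_fun R f -> definable_fun R (fun x => `|f x|).
Proof.
apply: definable_fun_comp.
have d0 (Y : Type) (cY : coordinates R Y) : definable_fun R (fun p : Y => 0 : R).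
  exact: definable_fun_cst.
have d (Y : Type) (cY : coordinates R Y) (g : Y -> 'rV[R]_n) (h : Y -> R) :
    definable_fun R g -> definable_fun R h -> definable R (fun p => `|g p| <= h p).
  move=> dg dh; apply: (definable_ext (P := fun p => 0 <= h p /\ forall i, `|g p 0 i| <= h p)).
    apply: definable_and; first exact: definable_le.
    apply: definable_forall_ord => i; apply: definable_le => //.
    by apply: definable_fun_norm; exact: definable_fun_coord.
  by move=> p; rewrite ler_rowP.
have d1 : definable_fun R (fun p : 'rV[R]_n * R => p.1).
  exact: (definable_fun_polynomial polynomial_map_fst).
have d2 : definable_fun R (fun p : 'rV[R]_n * R => p.2).
  exact: (definable_fun_polynomial polynomial_map_snd).
have e1 : definable_fun R (fun p : 'rV[R]_n * R * R => p.1.1).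
  exact: definable_fun_fst (definable_fun_polynomial polynomial_map_fst).
have e2 : definable_fun R (fun p : 'rV[R]_n * R * R => p.1.2).
  exact: definable_fun_snd (definable_fun_polynomial polynomial_map_fst).
have e3 : definable_fun R (fun p : 'rV[R]_n * R * R => p.2).
  exact: (definable_fun_polynomial polynomial_map_snd).
apply: (definable_ext (P := fun p : 'rV[R]_n * R =>
  `|p.1| <= p.2 /\ forall s, `|p.1| <= s -> p.2 <= s)).
  apply: definable_and; first exact: d.
  apply: definable_forall; apply: definable_imp; first exact: d.
  exact: (definable_le e2 e3).
move=> -[v r] /=; split=> [[vr H]|<-//].
by apply/eqP; rewrite eq_le vr H.
Qed.

End VectorNorms.

(** Reads the goal as a first-order formula and applies the closure property of
   each connective, quantifier and operation; atoms that are hypotheses, possibly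
   applied to definable arguments, end the recursion. *)
Ltac definability :=
  repeat first
  [ assumption
  | match goal with
    | |- definable _ (fun x => @?A x /\ @?B x) =>
        apply (definable_and (P := A) (Q := B))
    | |- definable _ (fun x => @?A x \/ @?B x) =>
        apply (definable_or (P := A) (Q := B))
    | |- definable _ (fun x => is_true (@?a x && @?b x)) =>
        apply (definable_andb (a := a) (b := b))
    | |- definable _ (fun x => ~ @?A x) => apply (definable_not (P := A))
    | |- definable _ (fun x => @?A x -> @?B x) =>
        apply (definable_imp (P := A) (Q := B))
    | |- definable _ (fun x => exists y, @?A x y) =>
        apply (definable_exists (P := A))
    | |- definable _ (fun x => @?f x = @?g x) =>
        apply (definable_eq (f := f) (g := g))
    | |- definable _ (fun x => is_true (@?f x < @?g x)) =>
        apply (definable_lt (f := f) (g := g))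
    | |- definable _ (fun x => is_true (@?f x <= @?g x)) =>
        apply (definable_le (f := f) (g := g))
    | |- definable _ (fun x => forall i : ordinal _, @?A i x) =>
        apply (definable_forall_ord (P := A))
    | |- definable _ (fun x => forall y, @?A x y) =>
        apply (definable_forall (P := A))
    | H : definable _ ?A |- definable _ (fun x => ?A (@?f x)) =>
        apply (definable_comp (f := f) H)
    | |- definable_fun _ (fun x => x) => apply definable_fun_id
    | |- definable_fun _ (fun x => ?c) => apply definable_fun_cst
    | |- definable_fun _ (fun x => (@?f x, @?g x)) =>
        apply (definable_fun_pair (f := f) (g := g))
    | |- definable_fun _ (fun x => (@?f x).1) =>
        apply (definable_fun_fst (f := f))
    | |- definable_fun _ (fun x => (@?f x).2) =>
        apply (definable_fun_snd (f := f))
    | |- definable_fun _ (fun x => @?f x + @?g x) =>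
        apply (definable_fun_add (f := f) (g := g))
    | |- definable_fun _ (fun x => @?f x * @?g x) =>
        apply (definable_fun_mul (f := f) (g := g))
    | |- definable_fun _ (fun x => - @?f x) =>
        apply (definable_fun_opp (f := f))
    | |- definable_fun _ (fun x => (@?f x)^-1) =>
        apply (definable_fun_inv (f := f))
    | |- definable_fun _ (fun x => @?f x - @?g x) =>
        apply (definable_fun_vecB (f := f) (g := g))
    | |- definable_fun _ (fun x => `|@?f x|) =>
        apply (definable_fun_norm (f := f))
    | |- definable_fun _ (fun x => `|@?f x|) =>
        apply (definable_fun_vecnorm (f := f))
    | |- definable_fun _ (fun x => Num.min (@?f x) (@?g x)) =>
        apply (definable_fun_min (f := f) (g := g))
    | |- definable_fun _ (fun x => fun_of_matrix (@?f x) _ ?i) =>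
        apply (definable_fun_coord (f := f))
    | |- definable_fun _ (fun x => const_mx (@?f x)) =>
        apply (definable_fun_const_mx (f := f))
    | H : definable_fun _ ?A |- definable_fun _ (fun x => ?A (@?f x)) =>
        apply (definable_fun_comp (f := f) H)
    end; cbv beta
  | intro; cbv beta ].

(** * Tameness of definable sets and functions of one variable *)
Section OneVariable.
Variable R : realType.
Implicit Types (P : R -> Prop) (F : R -> R) (c : R).

Lemma at_rightP c P :
  (\forall t \near c^'+, P t) <-> exists2 d, 0 < d & forall t, c < t < c + d -> P t.
Proof.
rewrite near_withinE; split=> [/nbhs_ballP[d /= d0 H]|[d d0 H]].
  exists d => // t /andP[ct td]; apply: H => //.
  by rewrite /ball /= distrC ger0_norm ?subr_ge0 ?ltW // ltrBlDl.
apply/nbhs_ballP; exists d => // t; rewrite /ball /= distrC => td ct.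
by apply: H; rewrite ct -ltrBlDl; apply: le_lt_trans td; exact: ler_norm.
Qed.

Lemma meval_horner (p : mpoly.mpoly 1 R) :
  exists q : {poly R}, forall v : 'rV[R]_1, mpoly.meval (v 0) p = q.[v 0 0].
Proof.
elim/mpoly.mpolyind: p => [|a m p _ _ [q qE]].
  by exists 0 => v; rewrite mpoly.meval0 horner0.
exists (a *: 'X^(mpoly.fun_of_multinom m 0) + q) => v.
rewrite mpoly.mevalD mpoly.mevalZ qE mpoly.mevalX big_ord1.
by rewrite hornerD hornerZ hornerXn.
Qed.

Lemma sgr_right (q : {poly R}) c :
  exists s : R, \forall t \near c^'+, Num.sg q.[t] = s.
Proof.
have [->|q0] := eqVneq q 0.
  by exists 0; apply: nearW => t; rewrite horner0 sgr0.
have cn : c < polyrcf.next_root q c (c + 1) by rewrite polyrcf.next_root_gt // ltrDl.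
exists (polyrcf.sgp_right q c); apply/at_rightP.
exists (polyrcf.next_root q c (c + 1) - c); first by rewrite subr_gt0.
move=> t; rewrite addrC subrK => H; apply: (@polyrcf.sgr_neighpr _ (c + 1)).
by rewrite /polyrcf.neighpr in_itv.
Qed.

(** A polynomial has constant sign on some interval with left end c, and the
   dichotomy passes to unions and complements. *)
Lemma definable_at_right P c : definable R P ->
  (\forall t \near c^'+, P t) \/ (\forall t \near c^'+, ~ P t).
Proof.
rewrite /definable; set S := (X in semialgebraic X) => hS.
suff : (\forall t \near c^'+, S (const_mx t)) \/ (\forall t \near c^'+, ~ S (const_mx t)).
  by rewrite /S /=; case=> H; [left|right]; apply: filterS H => t; rewrite mxE.
elim: _ / hS => {P S} [p|p|A B _ hA _ hB|A _ hA].
- have [q qE] := meval_horner p; have [s sE] := sgr_right q c.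
  have [s0|s0] := eqVneq s 0; [left|right]; apply: filterS sE => t;
    rewrite /= qE mxE.
    by rewrite s0 => /eqP; rewrite sgr_eq0 => /eqP.
  by move=> sqt qt; move: s0; rewrite -sqt qt sgr0 eqxx.
- have [q qE] := meval_horner p; have [s sE] := sgr_right q c.
  have [s0|s0] := eqVneq s 1; [left|right]; apply: filterS sE => t;
    rewrite /= qE mxE -sgr_cp0; first by rewrite s0 => ->.
  by move=> ->; exact/negP.
- case: hA hB => [hA _|hA [hB|hB]].
  + by left; apply: filterS hA => t; left.
  + by left; apply: filterS hB => t; right.
  + by right; apply: filterS2 hA hB => t ? ? [].
- by case: hA => hA; [right; apply: filterS hA => t ? []|left].
Qed.

Lemma definable_accumulation P c : definable R P ->
  (forall e, 0 < e -> exists2 t, c < t < c + e & P t) ->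
  \forall t \near c^'+, P t.
Proof.
move=> /(definable_at_right c)[//|/at_rightP[d d0 H]] acc.
by have [t td Pt] := acc _ d0; have := H _ td.
Qed.

Lemma definable_near X (cX : coordinates R X) (P : X -> R -> Prop) (c : X -> R) :
  definable_fun R c -> definable R (fun p : X * R => P p.1 p.2) ->
  definable R (fun x => \forall t \near (c x)^'+, P x t).
Proof.
move=> dc dP; apply: (definable_ext (P := fun x => exists d : R, 0 < d /\
    forall t : R, c x < t -> t < c x + d -> P x t)); last first.
  move=> x; split=> [[d [d0 H]]|/at_rightP[d d0 H]].
    by apply/at_rightP; exists d => // t /andP[]; exact: H.
  by exists d; split=> // t ? ?; apply: H; apply/andP.
have dP' : definable R (fun p : X * R * R => P p.1.1 p.2).
  apply: (definable_comp (f := fun p : X * R * R => (p.1.1, p.2)) dP).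
  definability.
definability.
Qed.

(** Both truth values of [F < r] are locally constant on a dense open set, for
   each rational r; a point common to these countably many sets, which Baire's
   theorem provides in every interval, is a point of continuity. *)
Lemma definable_continuous_at_right F c :
  definable_fun R F -> \forall t \near c^'+, {for t, continuous F}.
Proof.
move=> dF.
have dC : definable R (fun t => {for t, continuous F}).
  apply: (definable_ext (P := fun t : R => forall e : R, 0 < e -> exists d : R,
      0 < d /\ forall s : R, `|t - s| < d -> `|F t - F s| < e)); last first.
    move=> t; split=> [H|/cvgrPdist_lt H e /H /nbhs_ballP[d /= d0 H']].
      apply/cvgrPdist_lt => e /H[d [d0 H']].
      by apply/nbhs_ballP; exists d => // s ?; exact: H'.
    by exists d; split=> // s ts; exact: H'.
  definability.
apply: definable_accumulation dC _ => e e0.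
pose A (r : rat) : set R^o := [set t : R | F t < ratr r].
pose U (r : rat) : set R^o := interior (A r) `|` interior (~` A r).
(* Natural numbers that code no rational contribute the whole line. *)
pose V n : set R^o := if (unpickle n : option rat) is Some r then U r else setT.
have odV n : open (V n) /\ dense (V n).
  rewrite /V; case: unpickle => [r|]; last first.
    by split; [exact: openT|move=> O O0 _; rewrite setIT].
  split=> [|O [x Ox] oO]; first by apply: openU; exact: open_interior.
  have dA : definable R (A r) by rewrite /A /mkset; definability.
  have Ox' : \forall t \near x^'+, O t.
    by apply: cvg_within; exact: open_nbhs_nbhs.
  have HA (B : set R^o) : (\forall t \near x^'+, B t) -> O `&` interior B !=set0.
    move=> Bx; have /(at_rightP (x : R))[d d0 H] : \forall t \near (x : R)^'+, O t /\ B t.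
      exact: filterI.
    exists (x + d / 2); have xd : x < x + d / 2 < x + d by apply/andP; split; lra.
    split; first by case: (H _ xd).
    have /near_in_itvoo : x + d / 2 \in `]x, x + d[ by rewrite in_itv.
    by apply: filterS => t; rewrite in_itv => /H[].
  case: (definable_at_right x dA) => /HA[t [Ot Bt]]; exists t; split=> //.
    by left.
  by right.
have [||t [/= + Vt]] := Baire odV (O := `]c, c + e[%classic).
- by exists (c + e / 2); rewrite /= in_itv /=; apply/andP; split; lra.
- exact: itv_open.
rewrite in_itv /= => ct; exists t => //.
apply/cvgrPdist_lt => e' e'0.
have near_rat r : (\forall s \near t, F s < ratr r) \/ (\forall s \near t, ~ F s < ratr r).
  by have := Vt (pickle r) I; rewrite /V pickleK; case; [left|right].
have [|r1] := @rat_in_itvoo _ (F t - e') (F t); first by lra.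
have [|r2] := @rat_in_itvoo _ (F t) (F t + e'); first by lra.
rewrite !in_itv /= => /andP[tr2 r2e] /andP[er1 r1t].
have F2 : \forall s \near t, F s < ratr r2.
  by case: (near_rat r2) => // /nbhs_singleton; rewrite tr2.
have F1 : \forall s \near t, ~ F s < ratr r1.
  by case: (near_rat r1) => // /nbhs_singleton; rewrite ltNge ltW.
apply: filterS2 F1 F2 => s /negP; rewrite -leNgt => s1 s2.
by rewrite ltr_norml; apply/andP; split; lra.
Qed.

End OneVariable.

Section AtRight.
Variables (R : realType) (c : R).
Implicit Types P Q : R -> Prop.

Lemma at_right_and P Q : (\forall t \near c^'+, P t) ->
  (\forall t \near c^'+, Q t) -> \forall t \near c^'+, P t /\ Q t.
Proof. exact: filterI. Qed.

Lemma at_right_ex P : (\forall t \near c^'+, P t) -> exists t, P t.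
Proof.
move=> /at_rightP[d d0 H]; exists (c + d / 2); apply: H.
by apply/andP; split; lra.
Qed.

End AtRight.

Section Choice.
Context (R : realType) {X Y : Type} {cX : coordinates R X} {cY : coordinates R Y}.

(** Outside the domain of G the function takes the value y0, and this case is
   itself definable. *)
Lemma definable_choice (G : X -> Y -> Prop) (y0 : Y) :
  definable R (fun p : X * Y => G p.1 p.2) ->
  (forall x y y', G x y -> G x y' -> y = y') ->
  exists f : X -> Y, definable_fun R f /\ forall x y, G x y -> f x = y.
Proof.
move=> dG uG.
pose H x y := G x y \/ (~ (exists y, G x y) /\ y = y0).
have exH x : exists y, H x y.
  by have [[y Gy]|nG] := pselect (exists y, G x y); [exists y; left|exists y0; right].
have [f fE] := choice exH; exists f; split; last first.
  move=> x y Gxy; case: (fE x) => [Gf|[nG _]]; first exact: uG Gf Gxy.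
  by case: nG; exists y.
apply: (definable_ext (P := fun p => H p.1 p.2)).
  have dG' : definable R (fun p : X * Y * Y => G p.1.1 p.2).
    by apply: (definable_comp (f := fun p : X * Y * Y => (p.1.1, p.2)) dG); definability.
  by rewrite /H; definability.
move=> -[x y] /=; split=> [|<-]; last exact: fE.
case=> [Gxy|[nG ->]]; case: (fE x) => [Gf|[nG' //]]; first exact: uG Gf Gxy.
  by case: nG'; exists y.
by case: nG; exists (f x).
Qed.

End Choice.

Section Limits.
Variable R : realType.
Implicit Types (F q : R -> R).

(** The limit is the supremum of the r that are eventually below F: by the
   dichotomy, any larger number is eventually above F. *)
Lemma definable_cvg_at_right F (C : R) : definable_fun R F ->
  (\forall t \near (0:R)^'+, `|F t| <= C) -> exists l : R, F t @[t --> (0:R)^'+] --> l.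
Proof.
move=> dF bF.
pose S := [set r | \forall t \near (0:R)^'+, r <= F t].
have dr r : definable R (fun t => r <= F t) by definability.
have ubS r : S r -> r <= C.
  move=> Sr; have [t [rt]] := at_right_ex (at_right_and Sr bF).
  by apply: le_trans; exact: le_trans (ler_norm _).
have hS : has_sup S.
  split; last by exists C => r; exact: ubS.
  by exists (- C); apply: filterS bF => t; rewrite ler_norml => /andP[].
exists (sup S); apply/cvgrPdist_lt => e e0.
have [r Sr rS] := sup_adherent e0 hS.
have : ~ S (sup S + e / 2).
  by move=> /(ub_le_sup hS.2); apply/negP; rewrite -ltNge ltrDl divr_gt0.
case: (definable_at_right 0 (dr (sup S + e / 2))) => // H _.
apply: filterS2 Sr H => t rt /negP; rewrite -ltNge => tS.
by rewrite ltr_norml; apply/andP; split; lra.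
Qed.

(** The last point at which [q] is still above [q a] cannot lie before [b]. *)
Lemma right_nondecreasing q a b : a <= b ->
  (forall t, a <= t <= b -> {for t, continuous q}) ->
  (forall t, a <= t < b -> \forall s \near t^'+, q t <= q s) -> q a <= q b.
Proof.
move=> ab cq rq.
pose A := [set t | a <= t <= b /\ q a <= q t].
have hA : has_sup A.
  split; first by exists a; rewrite /A /= lexx ab.
  by exists b => t [/andP[]].
set s := sup A.
have ubA : ubound A s by exact: sup_upper_bound.
have sab : a <= s <= b.
  rewrite ubA /=; last by split=> //; rewrite lexx.
  by apply: sup_le_ub => [|t [/andP[]]]; first by case: hA.
have qs : q a <= q s.
  rewrite leNgt; apply/negP => qsa.
  have /cvgrPdist_lt /(_ _ _) := cq _ sab.
  move=> /(_ (q a - q s)); rewrite subr_gt0 => /(_ qsa) /nbhs_ballP[d /= d0 H].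
  have [t At st] := sup_adherent d0 hA.
  have := H t; rewrite /ball /= ger0_norm ?subr_ge0 ?ubA // => /(_ _).
  move=> /(_ _); rewrite ltrBlDr -ltrBlDl => /(_ st).
  by case: At => _ qat; rewrite ltr_norml => /andP[? ?]; lra.
have [<-//|sb] := eqVneq s b.
have {}sb : s < b by rewrite lt_neqAle sb; case/andP: sab.
have sab' : a <= s < b by rewrite sb andbT; case/andP: sab.
have H1 : \forall t \near s^'+, s < t by exact: nbhs_right_gt.
have H2 : \forall t \near s^'+, t < b by exact: nbhs_right_lt.
have [t [[qst st] tb]] := at_right_ex (at_right_and (at_right_and (rq _ sab') H1) H2).
have /ubA : A t.
  split; last exact: le_trans qst.
  by rewrite (ltW tb) andbT; case/andP: sab => /le_trans -> //; exact: ltW.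
by rewrite leNgt st.
Qed.

(** By the dichotomy, either q increases just after each small t, and then q is
   increasing; or it does so after no small t, and then q is nonincreasing, which
   is impossible for a positive function with limit 0. *)
Lemma definable_increasing_at_right q : definable_fun R q ->
  q t @[t --> (0:R)^'+] --> (0:R) -> (\forall t \near (0:R)^'+, 0 < q t) ->
  exists2 d, 0 < d & forall s t, 0 < s -> s < t -> t < d -> q s < q t.
Proof.
move=> dq q0 qpos.
have cq := definable_continuous_at_right 0 dq.
have dup : definable R (fun t => \forall s \near t^'+, q t < q s).
  by apply: (definable_near (P := fun t s => q t < q s)); definability.
have dpt t : definable R (fun s => q t < q s) by definability.
case: (definable_at_right 0 dup) => H.
  have /at_rightP[d d0 {}H] := at_right_and cq H; exists d => // s t s0 st td.
  have stb u : s <= u <= t -> 0 < u < 0 + d by rewrite add0r => ?; lra.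
  have [u [qsu su]] : exists u, q s < q u /\ s < u < t.
    have sI : s <= s <= t by rewrite lexx ltW.
    have [_ Hs] := H s (stb s sI).
    have H1 : \forall t \near s^'+, s < t by exact: nbhs_right_gt.
    have H2 : \forall u \near s^'+, u < t by exact: nbhs_right_lt.
    have [u [[? ?] ?]] := at_right_ex (at_right_and (at_right_and Hs H1) H2).
    by exists u; split=> //; apply/andP.
  apply: (lt_le_trans qsu); apply: right_nondecreasing => [|v uv|v uv].
  - by lra.
  - have vI : s <= v <= t by lra.
    by have [] := H v (stb v vI).
  - have vI : s <= v <= t by lra.
    by have [_] := H v (stb v vI); apply: filterS => w /ltW.
exfalso.
have /at_rightP[d d0 {}H] := at_right_and (at_right_and cq qpos) H.
have dd : 0 < d / 2 < 0 + d by rewrite add0r; lra.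
have [[_ qd] _] := H _ dd.
have : \forall t \near (0:R)^'+, q (d / 2) <= q t.
  apply/at_rightP; exists (d / 2); first by lra.
  move=> t; rewrite add0r => td.
  rewrite -lerN2; apply: (@right_nondecreasing (fun x => - q x)) => [|u ut|u ut].
  - by lra.
  - have [|[cu _] _] := H u; first by lra.
    exact: continuousN.
  - have [|[_ _] Hu] := H u; first by lra.
    case: (definable_at_right u (dpt u)) => [//|].
    by apply: filterS => w /negP; rewrite -leNgt lerN2.
move=> H1; move/cvgrPdist_lt: q0 => /(_ _ qd) q0.
have [t [q1]] := at_right_ex (at_right_and H1 q0).
by rewrite sub0r normrN => /(le_lt_trans (ler_norm _)); rewrite ltNge q1.
Qed.

End Limits.

Section VectorValues.
Variable R : realType.

Lemma ltr_rowP n (v : 'rV[R]_n) (r : R) : 0 < r ->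
  (forall i, `|v 0 i| < r) -> `|v| < r.
Proof.
move=> r0 vr; rewrite /Num.norm/= mx_normrE.
by apply/bigmax_ltP; split=> // -[i j] _ /=; rewrite ord1; exact: vr.
Qed.

Lemma definable_row_continuous_at_right n (F : R -> 'rV[R]_n) c :
  definable_fun R F -> \forall t \near c^'+, {for t, continuous F}.
Proof.
move=> dF.
have : \forall t \near c^'+, forall i : 'I_n, {for t, continuous (fun s => F s 0 i)}.
  apply: filter_forall => i; apply: definable_continuous_at_right.
  by definability.
apply: filterS => t ct; apply/cvgrPdist_lt => e e0.
have H i : \forall s \near t, `|F t 0 i - F s 0 i| < e.
  by move/cvgrPdist_lt: (ct i) => /(_ e e0).
apply: (@filterS _ (nbhs t) (nbhs_filter t) _ _ _
  (@filter_forall _ 'I_n _ (nbhs t) (nbhs_filter t) H)) => s {}H.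
by apply: ltr_rowP => // i; rewrite !mxE.
Qed.

End VectorValues.

Lemma definable_section (R : realType) m (M : set 'rV[R]_m) (f : 'rV[R]_m -> R) :
  definable R M -> definable_fun R f ->
  (\forall s \near (0 : R)^'+, exists z, [/\ M z, f z = s &
    forall w, M w -> f w = s -> w = z]) ->
  exists rho : R -> 'rV[R]_m, definable_fun R rho /\
    \forall s \near (0 : R)^'+, [/\ M (rho s), f (rho s) = s &
      forall w, M w -> f w = s -> w = rho s].
Proof.
move=> dM df /at_rightP[d d0 H].
pose G (s : R) z := 0 < s < d /\ (M z /\ f z = s).
have dG : definable R (fun p : R * 'rV[R]_m => G p.1 p.2) by rewrite /G; definability.
have [s z z'|rho [drho rhoG]] := definable_choice (0 : 'rV[R]_m) dG.
  rewrite /G => -[sd [Mz zs]] [_ [Mz' z's]].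
  have [|z0 [_ _ uz0]] := H s; first by rewrite add0r.
  by rewrite (uz0 z) // (uz0 z').
exists rho; split=> //; apply/at_rightP; exists d => // s sd.
have [z [Mz zs uz]] := H s sd.
have -> : rho s = z by apply: rhoG; split=> //; move: sd; rewrite add0r.
by split.
Qed.

(** * End points described by distances *)
Section MetricEnds.
Variables (R : realType) (m : nat).
Implicit Types (M : set 'rV[R]_m) (x y z w : 'rV[R]_m).

(** The definition of eta(M) by charts quantifies over functions. This one is
   first-order, hence defines a semialgebraic set, and end_pointsE shows that it
   is equivalent. *)
Definition metric_end M y := M y /\
  \forall s \near (0 : R)^'+, exists z, [/\ M z, `|z - y| = s &
    forall w, M w -> `|w - y| = s -> w = z].

Lemma definable_metric_end M : definable R M -> definable R (metric_end M).
Proof.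
move=> dM.
apply: definable_and => //; apply: (definable_near (P := fun y s => exists z,
  [/\ M z, `|z - y| = s & forall w, M w -> `|w - y| = s -> w = z])).
  by definability.
apply: (definable_ext (P := fun p : 'rV[R]_m * R => exists z : 'rV[R]_m,
  M z /\ (`|z - p.1| = p.2 /\ forall w : 'rV[R]_m, M w -> `|w - p.1| = p.2 -> w = z))).
  by definability.
by move=> p; split=> -[z]; [move=> [? []]|move=> [] ? ? ?]; exists z.
Qed.

(** The distance to x is increasing along the arc near 0, so the arc meets each
   small sphere around x once; the last hypothesis leaves no other point of M
   on it. *)
Lemma metric_end_chart M x (rho : R -> 'rV[R]_m) :
  definable R M -> M x -> definable_fun R rho ->
  rho t @[t --> (0 : R)^'+] --> x ->
  (\forall t \near (0 : R)^'+, M (rho t) /\ rho t <> x) ->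
  (forall e, 0 < e -> exists2 r, 0 < r & forall w, M w -> w <> x ->
     `|w - x| < r -> exists2 t, 0 < t < e & w = rho t) ->
  metric_end M x.
Proof.
move=> dM Mx drho rhox Mrho ball_arc; split=> //.
pose q (t : R) := `|rho t - x|.
have dq : definable_fun R q by rewrite /q; definability.
have q0 : q t @[t --> (0 : R)^'+] --> (0 : R).
  move/cvgrPdist_lt: rhox => rhox; apply/cvgrPdist_lt => e /rhox.
  by apply: filterS => t; rewrite sub0r normrN normr_id /q distrC.
have qpos : \forall t \near (0 : R)^'+, 0 < q t.
  apply: filterS Mrho => t [_ tx]; rewrite /q normr_gt0 subr_eq0; exact/eqP.
have [d d0 qmono] := definable_increasing_at_right dq q0 qpos.
have /at_rightP[e' e'0 Mr] : \forall t \near (0 : R)^'+, M (rho t) /\ 0 < q t.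
  by apply: filterS2 Mrho qpos => t [].
have {}Mr t : 0 < t < e' -> M (rho t) /\ 0 < q t.
  by move=> te; apply: Mr; rewrite add0r.
pose e := Num.min d e'; have e0 : 0 < e by rewrite lt_min d0.
have ed t : t < e -> t < d /\ t < e' by rewrite lt_min => /andP.
have dS : definable R (fun s : R => exists t : R, 0 < t /\ t < e /\ q t = s).
  by definability.
have S0 : \forall s \near (0 : R)^'+, exists t : R, 0 < t /\ t < e /\ q t = s.
  apply: definable_accumulation dS _ => a a0.
  have [t [qa te]] : exists t, q t < a /\ 0 < t < e.
    apply: at_right_ex (0 : R) _ _; apply: at_right_and.
      move/cvgrPdist_lt: q0 => /(_ _ a0); apply: filterS => t.
      by rewrite sub0r normrN normr_id.
    by apply/at_rightP; exists e => // t; rewrite add0r.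
  case/andP: te => t0 te; exists (q t); last by exists t.
  by rewrite add0r qa andbT; case: (Mr t) => //; rewrite t0; case: (ed _ te).
have [r r0 arc] := ball_arc _ e0.
have near_r : \forall s \near (0 : R)^'+, 0 < s < r.
  by apply/at_rightP; exists r => // t; rewrite add0r.
apply: filterS2 S0 near_r => s [t [t0 [te qs]]] /andP[s0 sr].
have [td te'] := ed _ te.
exists (rho t); split=> //; first by case: (Mr t); rewrite ?t0.
move=> w Mw ws.
have wx : w <> x by move=> wx; move: s0; rewrite -ws wx subrr normr0 ltxx.
have wr : `|w - x| < r by rewrite ws.
have [u /andP[u0 ue] wu] := arc w Mw wx wr.
have [ud _] := ed _ ue.
have qu : q u = q t by rewrite qs /q -wu.
case: (ltgtP u t) => [ut|tu|ut]; last by rewrite wu ut.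
- by move: (qmono _ _ u0 ut td); rewrite qu ltxx.
- by move: (qmono _ _ t0 tu ud); rewrite qu ltxx.
Qed.

Lemma metric_end_arc M y : definable R M -> metric_end M y ->
  exists rho : R -> 'rV[R]_m, definable_fun R rho /\
    \forall s \near (0 : R)^'+, [/\ M (rho s), `|rho s - y| = s &
      forall w, M w -> `|w - y| = s -> w = rho s].
Proof.
move=> dM [My H]; apply: (definable_section (f := fun z => `|z - y|)) => //.
by definability.
Qed.

(** A point z of the arc other than its origin has the arc on both sides. By the
   intermediate value theorem, each side has a point at distance s from z, for all
   small s, so z is not an end. *)
Lemma metric_end_isolated M y : definable R M -> metric_end M y ->
  exists2 d, 0 < d & forall z, M z -> 0 < `|z - y| < d -> ~ metric_end M z.
Proof.
move=> dM My; have [rho [drho arc]] := metric_end_arc dM My.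
have cr := definable_row_continuous_at_right 0 drho.
have /at_rightP[d d0 H] := at_right_and arc cr.
exists d => // z Mz zd [_ /at_rightP[e e0 uz]].
set t := `|z - y| in zd.
have [[Mt ty ut] ct] : [/\ M (rho t), `|rho t - y| = t &
    forall w, M w -> `|w - y| = t -> w = rho t] /\ {for t, continuous rho}.
  by apply: H; rewrite add0r.
have zt : z = rho t by exact: ut.
pose a u := `|rho u - z|.
have at0 : a t = 0 by rewrite /a -zt subrr normr0.
have ad u : 0 < u < d -> [/\ M (rho u), `|rho u - y| = u & {for u, continuous a}].
  move=> ud; have [|[Mu uy _] cu] := H u; first by rewrite add0r.
  split=> //; apply: cvg_norm; apply: cvgB => //; exact: cvg_cst.
have rho_inj u v : 0 < u < d -> 0 < v < d -> rho u = rho v -> u = v.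
  by move=> /ad[_ uE _] /ad[_ vE _] uv; rewrite -uE -vE uv.
have apos u : 0 < u < d -> u != t -> 0 < a u.
  move=> ud; rewrite normr_gt0 subr_eq0; apply: contra_neq; rewrite zt.
  exact: rho_inj.
have [_ _ cat] := ad _ zd.
have [k k0 ak] : exists2 k, 0 < k & forall u, `|t - u| < k -> 0 < u < d /\ a u < e.
  have : \forall u \near t, 0 < u < d /\ a u < e.
    apply: filterI.
      have /near_in_itvoo : t \in `]0, d[ by rewrite in_itv.
      by apply: filterS => u; rewrite in_itv.
    move/cvgrPdist_lt: cat => /(_ _ e0); apply: filterS => u.
    by rewrite at0 sub0r normrN; apply: le_lt_trans; exact: ler_norm.
  by move=> /nbhs_ballP[k /= k0 H']; exists k => // u; exact: H'.
pose u1 := t - k / 2; pose u2 := t + k / 2.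
have [u1d au1] : 0 < u1 < d /\ a u1 < e by apply: ak; rewrite /u1 ger0_norm; lra.
have [u2d au2] : 0 < u2 < d /\ a u2 < e by apply: ak; rewrite /u2 ler0_norm; lra.
pose s := Num.min (a u1) (a u2).
have p1 : 0 < a u1 by apply: apos => //; apply/eqP; rewrite /u1; lra.
have p2 : 0 < a u2 by apply: apos => //; apply/eqP; rewrite /u2; lra.
have s0 : 0 < s by rewrite lt_min p1.
have se : s < e by rewrite gt_min au1.
have within_a b c : 0 < b -> c < d -> {within `[b, c], continuous a}.
  move=> b0 cd; apply: continuous_in_subspaceT => u.
  rewrite inE /= in_itv /= => /andP[bu uc].
  by have [|_ _ //] := ad u; rewrite (lt_le_trans b0 bu) (le_lt_trans uc cd).
have [v1 + av1] : exists2 v, v \in `[u1, t] & a v = s.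
  apply: IVT; [by rewrite /u1; lra|by apply: within_a; lra|].
  by rewrite at0 (min_r (ltW p1)) (max_l (ltW p1)) (ltW s0) ge_min lexx.
have [v2 + av2] : exists2 v, v \in `[t, u2] & a v = s.
  apply: IVT; [by rewrite /u2; lra|by apply: within_a; lra|].
  by rewrite at0 (min_l (ltW p2)) (max_r (ltW p2)) (ltW s0) ge_min lexx orbT.
rewrite !in_itv /= => /andP[tv2 v2u] /andP[uv1 v1t].
have [|w [_ _ uw]] := uz s; first by rewrite add0r s0.
have v1d : 0 < v1 < d by lra.
have v2d : 0 < v2 < d by lra.
have [Mv1 _ _] := ad _ v1d; have [Mv2 _ _] := ad _ v2d.
have v12 : v1 = v2 by apply: rho_inj => //; rewrite (uw (rho v1)) // (uw (rho v2)).
have v1E : v1 = t by lra.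
by move: s0; rewrite -av1 v1E at0 ltxx.
Qed.
End MetricEnds.

Section Subspaces.
Variables (R : realType) (m : nat).
Implicit Types (M : set 'rV[R]_m).

Definition to_sub M x (Mx : M x) : M := SigSub (mem_set Mx).

Lemma set_type_mem M (x : M) : M (\val x).
Proof. exact: set_mem (valP x). Qed.

Lemma nbhs_subP M (x : M) (P : set M) :
  nbhs x P <-> exists2 d : R, 0 < d & forall y : M, `|\val x - \val y| < d -> P y.
Proof.
split=> [/nbhs_ballP[d /= d0 H]|[d d0 H]].
  exists d => // y xy; apply: H; rewrite /ball /= /initial_ball -ball_normE.
  exact: xy.
apply/nbhs_ballP; exists d => // y; rewrite /ball /= /initial_ball -ball_normE.
exact: H.
Qed.

Lemma continuous_subP (V : pseudoMetricNormedZmodType R) M (f : M -> V) :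
  continuous f <-> forall (x : M) (e : R), 0 < e -> exists2 d : R, 0 < d &
    forall y : M, `|\val x - \val y| < d -> `|f x - f y| < e.
Proof.
split=> [cf x e e0|H x].
  have : nbhs x [set y | `|f x - f y| < e].
    apply: (cf x [set z | `|f x - z| < e]); apply/nbhs_ballP; exists e => // z.
    by rewrite -ball_normE.
  by move/nbhs_subP.
move=> P /nbhs_ballP[e /= e0 HP]; apply/nbhs_subP; have [d d0 Hd] := H x e e0.
by exists d => // y /Hd fxy; apply: HP; rewrite -ball_normE.
Qed.

End Subspaces.

Section SubspaceMaps.
Variables (R : realType) (m n : nat).
Implicit Types (M : set 'rV[R]_m) (N : set 'rV[R]_n).

Lemma continuous_sub_subP M N (f : M -> N) :
  continuous f <-> forall (x : M) (e : R), 0 < e -> exists2 d : R, 0 < d &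
    forall y : M, `|\val x - \val y| < d -> `|\val (f x) - \val (f y)| < e.
Proof.
split=> [cf x e e0|H x].
  apply/nbhs_subP; apply: (cf x [set z | `|\val (f x) - \val z| < e]).
  by apply/nbhs_subP; exists e.
move=> P /nbhs_subP[e e0 HP]; apply/nbhs_subP; have [d d0 Hd] := H x e e0.
by exists d => // y /Hd /HP.
Qed.

End SubspaceMaps.

Section GraphMaps.
Variables (R : realType) (m n : nat) (M : set 'rV[R]_m) (f : M -> 'rV[R]_n).

Lemma map_graphP x y :
  map_graph f (row_mx x y) <-> exists Mx : M x, y = f (to_sub Mx).
Proof.
split=> [[z /eq_row_mx[-> ->]]|[Mx ->]]; last by exists (to_sub Mx).
by exists (set_type_mem z); congr f; exact: val_inj.
Qed.

Lemma definable_graphP :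
  semialgebraic (map_graph f) <->
  definable R (fun p : 'rV[R]_m * 'rV[R]_n => exists Mx : M p.1, p.2 = f (to_sub Mx)).
Proof.
have E (v : 'rV[R]_(m + n)) : map_graph f v <->
    exists Mx : M (lsubmx v), rsubmx v = f (to_sub Mx).
  by rewrite -map_graphP hsubmxK.
by split; congr semialgebraic; apply/seteqP; split=> v /E.
Qed.

End GraphMaps.

Lemma norm_const_mx (R : realType) (t : R) : `|const_mx t : 'rV[R]_1| = `|t|.
Proof.
apply/eqP; rewrite eq_le; apply/andP; split.
  by apply/ler_rowP; split=> // i; rewrite mxE.
by have /ler_rowP[_ /(_ 0)] := lexx `|const_mx t : 'rV[R]_1|; rewrite mxE.
Qed.

Section EndPoints.
Variables (R : realType) (m : nat) (M : set 'rV[R]_m).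
Hypothesis hM : semialgebraic M.

Let dM : definable R M. Proof. exact: hM. Qed.

Let unitP (t : R) : 0 <= t < 1 -> unit_co R (const_mx t : 'rV[R]_1).
Proof. by rewrite /unit_co /= mxE. Qed.

Lemma end_point_metric_end p : end_points M p -> metric_end M p.
Proof.
move=> [O [oO [sO [x [f [xp [[_ graphf] [g [fK gK cf cg]]] fx0]]]]]].
pose G (t : R) w := 0 < t < 1 /\ exists Mw : (M `&` O) w, const_mx t = \val (f (to_sub Mw)).
have dG : definable R (fun q : R * 'rV[R]_m => G q.1 q.2).
  rewrite /G; apply: definable_and; first by definability.
  move/definable_graphP: graphf => graphf.
  apply: (definable_comp (f := fun q : R * 'rV[R]_m => (q.2, const_mx q.1 : 'rV[R]_1)) graphf).
  by definability.
have uG t w w' : G t w -> G t w' -> w = w'.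
  move=> [_ [Mw tw]] [_ [Mw' tw']].
  have /(congr1 (fun z => \val (g z))) : f (to_sub Mw) = f (to_sub Mw').
    by apply: val_inj; rewrite -tw -tw'.
  by rewrite !fK.
have [rho [drho rhoG]] := definable_choice (0 : 'rV[R]_m) dG uG.
have rhoE t : 0 < t < 1 -> exists2 z : unit_co R, \val z = const_mx t & rho t = \val (g z).
  move=> t01; have t01' : 0 <= t < 1 by case/andP: t01 => /ltW -> ->.
  exists (to_sub (unitP t01')) => //; apply: rhoG; split=> //.
  exists (set_type_mem _); rewrite (_ : to_sub _ = g (to_sub (unitP t01'))).
    by rewrite gK.
  exact: val_inj.
have Mp : (M `&` O) p by rewrite -xp; exact: set_type_mem.
apply: (@metric_end_chart _ _ M p rho) => //.
- by case: Mp.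
- apply/cvgrPdist_lt => e e0.
  move/continuous_sub_subP: cg => /(_ (f x) e e0)[d d0 H].
  apply/at_rightP; exists (Num.min d 1); first by rewrite lt_min d0 ltr01.
  move=> t; rewrite add0r lt_min => /and3P[t0 td t1].
  have [|z zt ->] := rhoE t; first by rewrite t0.
  have := H z; rewrite fK xp fx0 zt sub0r normrN norm_const_mx gtr0_norm //.
  exact.
- apply/at_rightP; exists 1 => // t; rewrite add0r => t01.
  have [z zt ->] := rhoE _ t01; split; first by case: (set_type_mem (g z)).
  rewrite -xp => /val_inj gx; move: zt; rewrite -[z]gK gx fx0 => /matrixP/(_ 0 0).
  by rewrite !mxE => t0; move: t01; rewrite -t0 ltxx.
- move=> e e0; have /nbhs_ballP[r /= r0 rO] : nbhs p O.
    by apply: open_nbhs_nbhs; split=> //; case: Mp.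
  move/continuous_sub_subP: cf => /(_ x e e0)[d d0 H].
  exists (Num.min d r); first by rewrite lt_min d0.
  move=> w Mw wp; rewrite distrC lt_min => /andP[wd wr].
  have Mw' : (M `&` O) w by split=> //; apply: rO; rewrite -ball_normE.
  have := H (to_sub Mw'); rewrite xp => /(_ wd); rewrite fx0 sub0r normrN.
  set y := to_sub Mw'; have : unit_co R (\val (f y)) by exact: set_type_mem.
  have {1 2}-> : \val (f y) = const_mx (\val (f y) 0 0).
    by apply/rowP => i; rewrite mxE ord1.
  rewrite /unit_co /= mxE norm_const_mx => /andP[t0 t1] te.
  have t_gt0 : 0 < \val (f y) 0 0.
    rewrite lt_neqAle t0 andbT eq_sym; apply/eqP => ty0; apply: wp.
    rewrite -xp -[w]/(\val y) -(fK y) -(fK x); congr (\val (g _)); apply: val_inj.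
    by rewrite fx0; apply/rowP => i; rewrite ord1 ty0 mxE.
  exists (\val (f y) 0 0); first by rewrite t_gt0 -[X in X < _]gtr0_norm.
  apply/esym/rhoG; split; first by rewrite t_gt0.
  by exists Mw'; apply/rowP => i; rewrite mxE ord1.
Qed.

(** The chart is the distance to p divided by a constant, and its inverse is the
   arc of metric_end_arc. *)
Lemma metric_end_end_point p : metric_end M p -> end_points M p.
Proof.
move=> Ep; have [rho [drho arc]] := metric_end_arc dM Ep.
have cr := definable_row_continuous_at_right 0 drho.
have /at_rightP[d d0 H] := at_right_and arc cr.
pose arc0 t := if t == 0 then p else rho t.
have arc0P t : 0 <= t < d -> [/\ M (arc0 t), `|arc0 t - p| = t &
    forall w, M w -> `|w - p| = t -> w = arc0 t].
  move=> /andP[t0 td]; rewrite /arc0; have [->|tn0] := eqVneq t 0.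
    split; [by case: Ep|by rewrite subrr normr0|].
    by move=> w _ /eqP; rewrite normr_eq0 subr_eq0 => /eqP.
  by have [|] := H t; first by rewrite add0r lt_neqAle eq_sym tn0 t0.
have carc0 t e : 0 <= t < d -> 0 < e -> exists2 k, 0 < k &
    forall s, 0 <= s < d -> `|t - s| < k -> `|arc0 t - arc0 s| < e.
  move=> /andP[t0 td] e0; have [tE|tn0] := eqVneq t 0.
    exists e => // s sd; rewrite tE sub0r normrN; case: (arc0P _ sd) => _ se _.
    rewrite /arc0 eqxx distrC -/(arc0 s) se ger0_norm //; by case/andP: sd.
  have tp : 0 < t by rewrite lt_neqAle eq_sym tn0.
  have [|_ ct] := H t; first by rewrite add0r tp.
  move/cvgrPdist_lt: ct => /(_ _ e0) /nbhs_ballP[k /= k0 Hk].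
  exists (Num.min k t); first by rewrite lt_min k0.
  move=> s sd; rewrite lt_min => /andP[sk st].
  have sn0 : s != 0 by apply: contraTneq st => ->; rewrite subr0 gtr0_norm // ltxx.
  by rewrite /arc0 (negbTE tn0) (negbTE sn0); exact: Hk.
pose O : set 'rV[R]_m := [set w | `|w - p| < d].
have oO : open O.
  rewrite (_ : O = ball p d); first exact: ball_open.
  by apply/seteqP; split=> w; rewrite -ball_normE /= /O /= distrC.
exists O; split=> //; have sO : definable R (M `&` O).
  rewrite (_ : M `&` O = fun w => M w /\ `|w - p| < d) //; definability.
split; first exact: sO.
have Mp : (M `&` O) p by split; [case: Ep|rewrite /O /= subrr normr0].
have dist_unit (w : M `&` O) : unit_co R (const_mx (`|\val w - p| / d) : 'rV[R]_1).
  apply: unitP; apply/andP; split; first by rewrite divr_ge0 // ltW.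
  by rewrite ltr_pdivrMr // mul1r; have [] := set_type_mem w.
pose f (w : M `&` O) : unit_co R := to_sub (dist_unit w).
have zd (z : unit_co R) : 0 <= d * \val z 0 0 < d.
  have /andP[z0 z1] := set_type_mem z; apply/andP; split.
    by rewrite mulr_ge0 // ltW.
  by rewrite -{2}[d]mulr1 ltr_pM2l.
have arc_mem (z : unit_co R) : (M `&` O) (arc0 (d * \val z 0 0)).
  have [Mz zE _] := arc0P _ (zd z); split=> //.
  by rewrite /O /= zE; case/andP: (zd z).
pose g (z : unit_co R) : M `&` O := to_sub (arc_mem z).
exists (to_sub Mp), f; split=> //; last first.
  by rewrite /f /= subrr normr0 mul0r; apply/rowP => i; rewrite !mxE.
have cf : continuous f.
  apply/continuous_sub_subP => w e e0; exists (e * d); first exact: mulr_gt0.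
  move=> w'; rewrite /f /= => ww'.
  have -> : const_mx (`|\val w - p| / d) - const_mx (`|\val w' - p| / d) =
      const_mx ((`|\val w - p| - `|\val w' - p|) / d) :> 'rV[R]_1.
    by apply/rowP => i; rewrite !mxE mulrBl.
  rewrite norm_const_mx normrM normfV (gtr0_norm d0) ltr_pdivrMr //.
  apply: le_lt_trans ww'; apply: le_trans (ler_dist_dist _ _) _.
  by rewrite opprB addrA subrK.
split; first split.
- by apply/continuous_subP => w e e0; move/continuous_sub_subP: cf; exact.
- apply/definable_graphP; apply: (definable_ext (P := fun q : 'rV[R]_m * 'rV[R]_1 =>
    (M q.1 /\ `|q.1 - p| < d) /\ q.2 = const_mx (`|q.1 - p| / d))).
    by definability.
  by move=> [w v] /=; split=> [[Mw ->]|[Mw ->]]; [exists Mw|].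
exists g; split=> //.
- move=> w; apply: val_inj; rewrite /g /= mxE mulrC divfK ?gt_eqF //.
  have [Mw Ow] := set_type_mem w; have [|_ _ uw] := arc0P `|\val w - p|.
    by rewrite normr_ge0.
  exact/esym/uw.
- move=> z; apply: val_inj; rewrite /f /=; have [_ -> _] := arc0P _ (zd z).
  by rewrite mulrC mulKf ?gt_eqF //; apply/rowP => i; rewrite mxE ord1.
- apply/continuous_sub_subP => z e e0.
  have [k k0 Hk] := carc0 _ _ (zd z) e0; exists (k / d); first exact: divr_gt0.
  move=> z' zz'; apply: Hk (zd z') _.
  rewrite -mulrBr normrM (gtr0_norm d0) mulrC -ltr_pdivlMr //.
  apply: le_lt_trans zz'.
  by have /ler_rowP[_ /(_ 0)] := lexx `|\val z - \val z'|; rewrite !mxE.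
Qed.

Lemma end_pointsE : end_points M = metric_end M.
Proof.
by apply/seteqP; split=> p; [exact: end_point_metric_end|exact: metric_end_end_point].
Qed.

End EndPoints.

(** * Elements of S*(M) as functions on the whole space *)
Lemma cvg_min (R : realType) (T : Type) (F : set_system T) (FF : Filter F)
    (f g : T -> R) (a b : R) :
  f x @[x --> F] --> a -> g x @[x --> F] --> b ->
  Num.min (f x) (g x) @[x --> F] --> Num.min a b.
Proof.
move=> fa gb; rewrite minr_absE.
rewrite (_ : (fun x => _) = fun x => (f x + g x - `|f x - g x|) / 2); last first.
  by apply/funext => x; rewrite minr_absE.
apply: cvgMl; apply: cvgB; first exact: cvgD.
by apply: cvg_norm; exact: cvgB.
Qed.

Section TotalFunctions.
Variables (R : realType) (m : nat) (M : set 'rV[R]_m).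
Implicit Types (F G : 'rV[R]_m -> R) (x y z : 'rV[R]_m).

Definition continuous_on F := forall x, M x -> F z @[z --> within M (nbhs x)] --> F x.

Lemma continuous_onP F : continuous_on F <-> forall x (e : R), M x -> 0 < e ->
  exists2 d : R, 0 < d & forall y, M y -> `|x - y| < d -> `|F x - F y| < e.
Proof.
split=> [cF x e Mx e0|H x Mx].
  have /cvgrPdist_lt/(_ _ e0) := cF _ Mx.
  rewrite near_withinE => /nbhs_ballP[d /= d0 H]; exists d => // y My xy.
  by apply: H => //; rewrite -ball_normE.
apply/cvgrPdist_lt => e e0; rewrite near_withinE; have [d d0 Hd] := H x e Mx e0.
by apply/nbhs_ballP; exists d => // y + My; rewrite -ball_normE => /Hd; exact.
Qed.

(** Extension by 0 of a function on the subtype of M, so that definability refers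
   to functions on R^m only. *)
Definition ext0 (f : M -> R) x : R :=
  if pselect (M x) is left Mx then f (to_sub Mx) else 0.

Lemma ext0E (f : M -> R) (x : M) : ext0 f (\val x) = f x.
Proof.
rewrite /ext0; case: pselect => [Mx|/(_ (set_type_mem x))//].
by congr f; exact: val_inj.
Qed.

Lemma ext0_to_sub (f : M -> R) x (Mx : M x) : ext0 f x = f (to_sub Mx).
Proof. exact: (ext0E f (to_sub Mx)). Qed.

(** The conditions under which the restriction of F to M is an element of S*(M). *)
Record admissible F : Prop := Admissible {
  admissible_definable : definable_fun R F;
  admissible_continuous : continuous_on F;
  admissible_bounded : exists C : R, forall x, M x -> `|F x| <= C }.

Hypothesis hM : semialgebraic M.
Let dM : definable R M. Proof. exact: hM. Qed.

Lemma admissible_ext0 (f : Sstar hM) : admissible (ext0 f).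
Proof.
have /asboolP[cf sf [C0 [_ bf]]] := SstarP f.
have gE : forall x (r : R), ext0 f x = r <->
    (exists Mx : M x, const_mx r = const_mx (f (to_sub Mx)) :> 'rV[R]_1) \/
    (~ M x /\ r = 0).
  move=> x r; split=> [<-|[[Mx /matrixP/(_ 0 0)]|[nMx ->]]].
  - rewrite /ext0; case: pselect => [Mx|nMx]; last by right.
    by left; exists Mx.
  - by rewrite !mxE => ->; rewrite ext0_to_sub.
  - by rewrite /ext0; case: pselect.
split.
- move/definable_graphP: sf => sf.
  have d1 : definable R (fun p : 'rV[R]_m * R => exists Mx : M p.1,
      const_mx p.2 = const_mx (f (to_sub Mx)) :> 'rV[R]_1).
    apply: (definable_comp (f := fun q : 'rV[R]_m * R => (q.1, const_mx q.2 : 'rV[R]_1)) sf).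
    by definability.
  have d2 : definable R (fun p : 'rV[R]_m * R => ~ M p.1 /\ p.2 = 0) by definability.
  by apply: (definable_ext (definable_or d1 d2)) => -[x r]; rewrite gE.
- apply/continuous_onP => x e Mx e0.
  move/continuous_subP: cf => /(_ (to_sub Mx) e e0)[d d0 H]; exists d => // y My xy.
  by rewrite (ext0_to_sub _ Mx) (ext0_to_sub _ My); exact: H.
- exists (C0 + 1) => x Mx; rewrite (ext0_to_sub _ Mx).
  by apply: (bf (C0 + 1)) => //; rewrite ltrDl.
Qed.

Lemma admissible_bounded_semialgebraic F : admissible F ->
  (fun x : M => F (\val x)) \in @bounded_semialgebraic R m M.
Proof.
move=> [dF cF [C bF]]; apply/asboolP; split.
- apply/continuous_subP => x e e0.
  move/continuous_onP: cF => /(_ (\val x) e (set_type_mem x) e0)[d d0 H].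
  exists d => // y xy.
  by apply: H => //; exact: set_type_mem.
- apply/definable_graphP.
  apply: (definable_ext (P := fun p : 'rV[R]_m * 'rV[R]_1 => M p.1 /\ p.2 = const_mx (F p.1))).
    by definability.
  by move=> [x v] /=; split=> [[Mx ->]|[Mx ->]]; [exists Mx|].
- exists C; split; first exact: num_real.
  by move=> D CD x _; apply: le_trans (ltW CD); apply: bF; exact: set_type_mem.
Qed.

Definition Sstar_of F (aF : admissible F) : Sstar hM :=
  MkSstar hM (admissible_bounded_semialgebraic aF).

Lemma ext0_Sstar_of F (aF : admissible F) x : M x -> ext0 (Sstar_of aF) x = F x.
Proof. by move=> Mx; rewrite (ext0_to_sub _ Mx). Qed.

Lemma Sstar_eqP (f g : Sstar hM) :
  (forall x, M x -> ext0 f x = ext0 g x) -> f = g.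
Proof.
move=> fg; apply: val_inj; apply/funext => x.
by have := fg _ (set_type_mem x); rewrite !ext0E.
Qed.

Lemma ext0D (f g : Sstar hM) x : M x -> ext0 (f + g) x = ext0 f x + ext0 g x.
Proof. by move=> Mx; rewrite !(ext0_to_sub _ Mx). Qed.

Lemma ext0B (f g : Sstar hM) x : M x -> ext0 (f - g) x = ext0 f x - ext0 g x.
Proof. by move=> Mx; rewrite !(ext0_to_sub _ Mx). Qed.

Lemma ext0M (f g : Sstar hM) x : M x -> ext0 (f * g) x = ext0 f x * ext0 g x.
Proof. by move=> Mx; rewrite !(ext0_to_sub _ Mx). Qed.

Lemma ext01 x : M x -> ext0 (1 : Sstar hM) x = 1.
Proof. by move=> Mx; rewrite !(ext0_to_sub _ Mx). Qed.

Lemma admissible_cst (r : R) : admissible (fun=> r).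
Proof.
split; [exact: definable_fun_cst|by move=> x _; exact: cvg_cst|by exists `|r|].
Qed.

Lemma admissible_inv F (e : R) : 0 < e -> (forall x, M x -> e <= F x) ->
  admissible F -> admissible (fun x => (F x)^-1).
Proof.
move=> e0 eF [dF cF _]; split; first by definability.
  move=> x Mx; apply: cvgV; last exact: cF.
  by rewrite gt_eqF // (lt_le_trans e0) // eF.
exists e^-1 => x Mx; have Fx0 := lt_le_trans e0 (eF _ Mx).
by rewrite normfV gtr0_norm // lef_pV2 ?posrE // eF.
Qed.

Lemma admissible_dist z : admissible (fun x => Num.min 1 `|x - z|).
Proof.
have z0 x : 0 <= Num.min 1 `|x - z| by rewrite le_min ler01 normr_ge0.
split; first by definability.
  move=> x Mx; apply: cvg_min; first exact: cvg_cst.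
  apply: cvg_norm; apply: cvgB; last exact: cvg_cst.
  exact: cvg_within.
by exists 1 => x Mx; rewrite ger0_norm // ge_min lexx.
Qed.

Lemma admissible_weight : admissible (fun x => (1 + `|x|)^-1).
Proof.
have z0 x : 1 <= 1 + `|x| by rewrite lerDl.
split; first by definability.
  move=> x Mx; apply: cvgV; first by rewrite gt_eqF // (lt_le_trans _ (z0 x)).
  apply: cvgD; first exact: cvg_cst.
  by apply: cvg_norm; exact: cvg_within.
exists 1 => x _; rewrite normfV ger0_norm; last exact: le_trans ler01 _.
by rewrite invf_le1 // (lt_le_trans _ (z0 x)).
Qed.

Lemma admissible_coord i : admissible (fun x => x 0 i / (1 + `|x|)).
Proof.
split; first by definability.
  move=> x Mx; apply: cvgM; last first.
    exact: (admissible_continuous admissible_weight).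
  move: x Mx; apply/continuous_onP => x e _ e0; exists e => // y _.
  apply: le_lt_trans; have /ler_rowP[_ /(_ i)] := lexx `|x - y|.
  by rewrite !mxE.
exists 1 => x _; have p : 0 < 1 + `|x| by rewrite ltr_pwDl.
rewrite normrM normfV (gtr0_norm p) ler_pdivrMr // mul1r.
have /ler_rowP[_ /(_ i) xi] := lexx `|x|.
by apply: le_trans xi _; rewrite lerDr.
Qed.

End TotalFunctions.

(** * Characters *)

(** Nonnegative reals are squares, so h is monotone; and h fixes the rationals. *)
Lemma real_endomorphism_id (R : realType) (h : R -> R) :
  h 1 = 1 -> {morph h : x y / x + y} -> {morph h : x y / x * y} -> h =1 id.
Proof.
move=> h1 hD hM.
have h0 : h 0 = 0 by apply: (addIr (h 0)); rewrite -hD !add0r.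
have hN x : h (- x) = - h x by apply: (addIr (h x)); rewrite -hD !addNr.
have hB : zmod_morphism h by move=> x y; rewrite hD hN.
have hM1 : monoid_morphism h by split.
pose H : {rmorphism R -> R} := HB.pack h (GRing.isZmodMorphism.Build R R h hB)
  (GRing.isMonoidMorphism.Build R R h hM1).
have hq (q : rat) : h (ratr q) = ratr q by exact: (fmorph_rat H).
have hpos x : 0 <= x -> 0 <= h x.
  by move=> x0; rewrite -(sqr_sqrtr x0) expr2 hM -expr2 sqr_ge0.
have hmono x y : x <= y -> h x <= h y.
  by move=> xy; rewrite -subr_ge0 -hN -hD; apply: hpos; rewrite subr_ge0.
move=> x; case: (ltgtP (h x) x) => // /rat_in_itvoo[q];
    rewrite in_itv /= => /andP[q1 q2]; exfalso.
  by move: (hmono _ _ (ltW q2)); rewrite hq leNgt q1.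
by move: (hmono _ _ (ltW q1)); rewrite hq leNgt q2.
Qed.

Section Characters.
Variables (R : realType) (m : nat) (M : set 'rV[R]_m) (hM : semialgebraic M).

Record character (c : Sstar hM -> R) : Prop := Character {
  character1 : c 1 = 1;
  characterD : {morph c : f g / f + g};
  characterM : {morph c : f g / f * g} }.

Definition cst_Sstar (r : R) : Sstar hM := Sstar_of hM (admissible_cst M r).

Lemma ext0_cst r x : M x -> ext0 (cst_Sstar r) x = r.
Proof. exact: ext0_Sstar_of. Qed.

Lemma character_eval_at x : M x -> character (fun f : Sstar hM => ext0 f x).
Proof.
by move=> Mx; split=> [|f g|f g]; rewrite ?ext01 ?ext0D ?ext0M.
Qed.

Variable (c : Sstar hM -> R).
Hypothesis chc : character c.

Lemma character_cst r : c (cst_Sstar r) = r.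
Proof.
case: chc => c1 cD cM; apply: (real_endomorphism_id (h := c \o cst_Sstar)) => /=.
- by rewrite -[RHS]c1; congr c; apply: Sstar_eqP => x Mx; rewrite ext0_cst // ext01.
- by move=> a b; rewrite -cD; congr c; apply: Sstar_eqP => x Mx; rewrite ext0D // !ext0_cst.
- by move=> a b; rewrite -cM; congr c; apply: Sstar_eqP => x Mx; rewrite ext0M // !ext0_cst.
Qed.

(** If no such point existed, the sum of the squares of [f - c f] and [g - c g]
   would be bounded away from zero, hence a unit killed by the character. *)
Lemma character_dense (f g : Sstar hM) (e : R) : 0 < e ->
  exists x, [/\ M x, `|ext0 f x - c f| < e & `|ext0 g x - c g| < e].
Proof.
move=> e0; apply: contrapT => nx.
pose f' := f + cst_Sstar (- c f); pose g' := g + cst_Sstar (- c g).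
pose h := f' * f' + g' * g'.
have hE x : M x -> ext0 h x = (ext0 f x - c f) ^+ 2 + (ext0 g x - c g) ^+ 2.
  by move=> Mx; rewrite /h /f' /g' ext0D // !ext0M // !ext0D // !ext0_cst // !expr2.
have he x : M x -> e ^+ 2 <= ext0 h x.
  move=> Mx; rewrite hE // leNgt; apply/negP => lt_e; apply: nx; exists x.
  have bound (a b : R) : a ^+ 2 + b ^+ 2 < e ^+ 2 -> `|a| < e.
    move=> ab; rewrite -(gtr0_norm e0) -ltr_sqr ?nnegrE //.
    by rewrite !real_normK ?num_real //; apply: le_lt_trans ab; rewrite lerDl sqr_ge0.
  by split=> //; [exact: bound lt_e|apply: (bound _ (ext0 f x - c f)); rewrite addrC].
pose k := Sstar_of hM (admissible_inv (exprn_gt0 2 e0) he (admissible_ext0 h)).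
have hk : h * k = 1.
  apply: Sstar_eqP => x Mx; rewrite ext0M // ext01 // ext0_Sstar_of // mulfV //.
  by rewrite gt_eqF // (lt_le_trans (exprn_gt0 2 e0)) // he.
have ch : c h = 0.
  case: chc => _ cD cM.
  by rewrite /h cD !cM /f' /g' !cD !character_cst !subrr mulr0 addr0.
by move/eqP: (character1 chc); rewrite -hk (characterM chc) ch mul0r eq_sym oner_eq0.
Qed.

(** Evaluations at points where g is close to c g converge to c, and by hypothesis
   these points converge to z. *)
Lemma character_eval (g : Sstar hM) z : M z ->
  (forall e : R, 0 < e -> exists2 d : R, 0 < d & forall w, M w ->
     `|ext0 g w - c g| < d -> `|z - w| < e) ->
  forall f : Sstar hM, c f = ext0 f z.
Proof.
move=> Mz gz f; apply/eqP; rewrite -subr_eq0 -normr_le0; apply/ler_addgt0Pr => e e0.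
rewrite add0r.
have [_ /continuous_onP cf _] := admissible_ext0 f.
have e20 : 0 < e / 2 by rewrite divr_gt0.
have [d d0 Hd] := cf z (e / 2) Mz e20.
have [d' d'0 Hd'] := gz d d0.
have [|x [Mx gx fx]] := @character_dense g f (Num.min d' (e / 2)).
  by rewrite lt_min d'0.
move: gx fx; rewrite !lt_min => /andP[gx _] /andP[_ fx].
have zx := Hd x Mx (Hd' _ Mx gx).
rewrite (_ : c f - ext0 f z = - (ext0 f x - c f) - (ext0 f z - ext0 f x)); last by ring.
apply: le_trans (ler_normB _ _) _; rewrite normrN; lra.
Qed.

End Characters.

(** * Positive functions whose small level sets shrink to a single character *)
Section Fibers.
Variables (R : realType) (n : nat) (N : set 'rV[R]_n).
Hypothesis dN : definable R N.
Variable f : 'rV[R]_n -> R.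
Hypotheses (af : admissible N f) (fpos : forall x, N x -> 0 < f x).

Let fiber_inf (v : 'rV[R]_n -> R) : admissible N v ->
  exists a : R -> R, definable_fun R a /\ forall x, N x ->
    a (f x) <= v x /\
    forall y, (forall x', N x' -> f x' = f x -> y <= v x') -> y <= a (f x).
Proof.
move=> [dv _ [C bv]]; have [df _ _] := af.
pose G (t y : R) := (forall x : 'rV[R]_n, N x -> f x = t -> y <= v x) /\
  forall y' : R, (forall x : 'rV[R]_n, N x -> f x = t -> y' <= v x) -> y' <= y.
have dG : definable R (fun p : R * R => G p.1 p.2) by rewrite /G; definability.
have [t y y' [yl yg] [yl' yg']|a [da aG]] := definable_choice (0 : R) dG.
  by apply/eqP; rewrite eq_le yg' // yg.
exists a; split=> // x Nx.
suff [H1 H2] : G (f x) (a (f x)) by split; [exact: H1|exact: H2].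
pose S := [set r | exists x', [/\ N x', f x' = f x & r = v x']].
have lbS : lbound S (- C).
  by move=> _ [x' [Nx' _ ->]]; have := bv _ Nx'; rewrite ler_norml => /andP[].
have infS : G (f x) (inf S).
  split=> [x' Nx' fx'|y' H].
    by apply: ge_inf; [exists (- C)|exists x'].
  by apply: lb_le_inf; [exists (v x), x|move=> _ [x' [Nx' fx' ->]]; exact: H].
by rewrite (aG _ _ infS).
Qed.

Hypothesis lim_f : forall u, admissible N u -> exists l : R, forall e : R, 0 < e ->
  exists2 d : R, 0 < d & forall x, N x -> f x < d -> `|u x - l| < e.

(** Otherwise, rescale [v] on each level set of [f] to have infimum 0 and
   supremum 1: the resulting function has no limit as [f] tends to 0. The level
   is capped at a small constant, which makes the function bounded and
   continuous on all of [N]. *)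
Lemma constant_on_fibers v : admissible N v ->
  \forall t \near (0 : R)^'+, forall x x', N x -> N x' -> f x = t -> f x' = t -> v x = v x'.
Proof.
move=> av; have [dv cv [C bv]] := av; have [df cf _] := af.
pose P (t : R) := exists x : 'rV[R]_n, exists x' : 'rV[R]_n,
  N x /\ (N x' /\ (f x = t /\ (f x' = t /\ v x < v x'))).
have dP : definable R P by rewrite /P; definability.
case: (definable_at_right 0 dP) => [Pnear|]; last first.
  apply: filterS => t nP x x' Nx Nx' fx fx'.
  by case: (ltgtP (v x) (v x')) => // H; case: nP; [exists x, x'|exists x', x].
exfalso; have [a [da aE]] := fiber_inf av.
have [b' [db' b'E]] : exists b' : R -> R, definable_fun R b' /\ forall x, N x ->
    b' (f x) <= - v x /\
    forall y, (forall x', N x' -> f x' = f x -> y <= - v x') -> y <= b' (f x).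
  apply: (fiber_inf (v := fun x => - v x)); split; first by definability.
    by move=> x Nx; apply: cvgN; exact: cv.
  by exists C => x Nx; rewrite normrN; exact: bv.
pose b t := - b' t.
have ca := definable_continuous_at_right 0 da.
have cb := definable_continuous_at_right 0 db'.
have /at_rightP[d0 d00 H] := at_right_and Pnear (at_right_and ca cb).
pose d := d0 / 2; have dd : 0 < d < d0 by rewrite /d; lra.
have {}H t : 0 < t <= d -> [/\ P t, {for t, continuous a} & {for t, continuous b'}].
  by move=> td; have [|? []] := H t; first by rewrite add0r; lra.
have ab t : 0 < t <= d -> 0 < b t - a t.
  move=> /H[[x [x' [Nx [Nx' [fx [fx' xx']]]]]] _ _].
  have [ax _] := aE _ Nx; have [bx _] := b'E _ Nx'.
  by rewrite fx in ax; rewrite fx' in bx; rewrite /b; lra.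
(* Beyond the level d, the functions a and b need not be continuous. *)
pose tau x := Num.min (f x) d.
have tauP x : N x -> 0 < tau x <= d.
  by move=> Nx; rewrite /tau lt_min fpos //= ge_min lexx orbT andbT; lra.
pose u x := (v x - a (tau x)) / (b (tau x) - a (tau x)).
have fiber_u x : N x -> f x <= d -> 0 <= u x <= 1.
  move=> Nx fxd; have tE : tau x = f x by rewrite /tau min_l.
  have [ax _] := aE _ Nx; have [bx _] := b'E _ Nx.
  have abx := ab _ (tauP _ Nx); rewrite /u.
  by rewrite ler_pdivlMr // ler_pdivrMr // mul0r mul1r tE /b; lra.
have abd : 0 < b d - a d by apply: ab; lra.
have au : admissible N u.
  split.
  - rewrite /u /tau /b; definability.
  - move=> x Nx; have [_ cax cbx] := H _ (tauP _ Nx).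
    have ctau : tau z @[z --> within N (nbhs x)] --> tau x.
      by apply: cvg_min; [exact: cf|exact: cvg_cst].
    have catau : a (tau z) @[z --> within N (nbhs x)] --> a (tau x) by exact: cvg_comp ctau cax.
    have cbtau : b (tau z) @[z --> within N (nbhs x)] --> b (tau x).
      by apply: cvgN; exact: cvg_comp ctau cbx.
    apply: cvgM; first by apply: cvgB => //; exact: cv.
    apply: cvgV; first by rewrite gt_eqF // ab // tauP.
    exact: cvgB.
  - have C0 x : N x -> 0 <= C by move=> Nx; apply: le_trans (bv _ Nx).
    exists (1 + (C + `|a d|) / (b d - a d)) => x Nx.
    have D0 : 0 <= (C + `|a d|) / (b d - a d).
      by rewrite divr_ge0 ?(ltW abd) // addr_ge0 // (C0 x).
    case: (leP (f x) d) => [fxd|dfx].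
      have /andP[u0 u1] := fiber_u _ Nx fxd.
      by rewrite ger0_norm //; apply: le_trans u1 _; rewrite lerDl.
    rewrite /u /tau (min_r (ltW dfx)) normrM normfV (gtr0_norm abd).
    apply: le_trans (_ : (C + `|a d|) / (b d - a d) <= _); last by rewrite lerDr.
    rewrite ler_pM2r ?invr_gt0 //; apply: le_trans (ler_normB _ _) _.
    by rewrite lerD2r; exact: bv.
have [l Hl] := lim_f au; have [|e e0 He] := Hl (1 / 4); first by lra.
pose t := Num.min d e / 2.
have m0 : 0 < Num.min d e by rewrite lt_min e0; lra.
have md : Num.min d e <= d by rewrite ge_min lexx.
have me : Num.min d e <= e by rewrite ge_min lexx orbT.
have t0 : 0 < t by rewrite /t; lra.
have td : t <= d by rewrite /t; lra.
have te : t < e by rewrite /t; lra.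
have tI : 0 < t <= d by rewrite t0.
have abt := ab _ tI.
have [[x0 [_ [Nx0 [_ [fx0 _]]]]] _ _] := H _ tI.
have [x [Nx fx vx]] : exists x, [/\ N x, f x = t & v x < a t + (b t - a t) / 4].
  apply: contrapT => nx; have [_ aE0] := aE _ Nx0.
  have : a t + (b t - a t) / 4 <= a (f x0).
    apply: aE0 => x Nx fx; rewrite leNgt; apply/negP => vx; apply: nx.
    by exists x; rewrite fx fx0.
  by rewrite fx0; lra.
have [x' [Nx' fx' vx']] : exists x, [/\ N x, f x = t & b t - (b t - a t) / 4 < v x].
  apply: contrapT => nx; have [_ bE0] := b'E _ Nx0.
  have : - (b t - (b t - a t) / 4) <= b' (f x0).
    apply: bE0 => x' Nx' fx'; rewrite lerN2 leNgt; apply/negP => vx'; apply: nx.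
    by exists x'; rewrite fx' fx0.
  by rewrite fx0 -[b' t]opprK -/(b t); lra.
have ux : u x < 1 / 4.
  by rewrite /u /tau fx (min_l td) ltr_pdivrMr //; lra.
have ux' : 3 / 4 < u x'.
  by rewrite /u /tau fx' (min_l td) ltr_pdivlMr //; lra.
have := He _ Nx; have := He _ Nx'; rewrite fx fx' => /(_ te) + /(_ te).
by rewrite !ltr_norml => /andP[? ?] /andP[? ?]; lra.
Qed.

End Fibers.

Section Coordinates.
Variables (R : realType) (m : nat) (M : set 'rV[R]_m) (hM : semialgebraic M).

(** The functions 1 / (1 + |x|) and x_i / (1 + |x|) are bounded, and together they
   determine x. *)
Definition chart_Sstar (i : option 'I_m) : Sstar hM :=
  if i is Some j then Sstar_of hM (admissible_coord M j)
  else Sstar_of hM (admissible_weight M).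

Lemma chart_Sstar_inj x y : M x -> M y ->
  (forall i, ext0 (chart_Sstar i) x = ext0 (chart_Sstar i) y) -> x = y.
Proof.
move=> Mx My xy; have := xy None; rewrite !ext0_Sstar_of // => w.
apply/rowP => j; have := xy (Some j); rewrite !ext0_Sstar_of // w.
apply: mulIf; rewrite invr_eq0 gt_eqF //.
by rewrite (lt_le_trans ltr01) // lerDl.
Qed.

Definition dist_Sstar z : Sstar hM := Sstar_of hM (admissible_dist M z).

Lemma ext0_dist z w : M w -> ext0 (dist_Sstar z) w = Num.min 1 `|w - z|.
Proof. exact: ext0_Sstar_of. Qed.

Lemma dist_lt z w (e : R) : M w -> ext0 (dist_Sstar z) w < Num.min e 1 -> `|w - z| < e.
Proof.
move=> Mw; rewrite ext0_dist // lt_min => /andP[+ lt1].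
by rewrite min_r // leNgt; apply/negP => lt2; move: lt1; rewrite min_l ?ltxx // ltW.
Qed.

Lemma character_dist_ge0 (c : Sstar hM -> R) z : character c -> 0 <= c (dist_Sstar z).
Proof.
move=> chc; rewrite leNgt; apply/negP => cz.
have [|x [Mx + _]] := character_dense chc (dist_Sstar z) 0 (e := - c (dist_Sstar z)).
  by rewrite oppr_gt0.
rewrite ext0_dist // ltNge => /negP; apply.
have x0 : 0 <= Num.min 1 `|x - z| by rewrite le_min ler01 normr_ge0.
by apply: le_trans (ler_norm _); rewrite lerBrDr addNr.
Qed.

Lemma character_dist_eq0 (c : Sstar hM -> R) z :
  character c -> M z -> c (dist_Sstar z) = 0 ->
  forall f, c f = ext0 f z.
Proof.
move=> chc Mz cz; apply: (character_eval chc (g := dist_Sstar z) Mz) => e e0.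
exists (Num.min e 1); first by rewrite lt_min e0 ltr01.
move=> w Mw; rewrite cz subr0 distrC => H; apply: dist_lt => //.
exact: le_lt_trans (ler_norm _) H.
Qed.

(** If the small level sets of g are the points of a continuous curve rho, then a
   character with a small positive value s at g is the evaluation at rho s. *)
Lemma character_section (c : Sstar hM -> R) (g : Sstar hM)
    (rho : R -> 'rV[R]_m) (d : R) :
  character c ->
  (forall s, 0 < s < d -> [/\ M (rho s), {for s, continuous rho} &
     forall w, M w -> ext0 g w = s -> w = rho s]) ->
  0 < c g < d -> forall f, c f = ext0 f (rho (c g)).
Proof.
move=> chc H cgd; have [Mr cr _] := H _ cgd.
apply: (character_eval chc (g := g) Mr) => e e0.
have : \forall s \near c g, 0 < s < d /\ `|rho (c g) - rho s| < e.
  apply: filterI.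
    have /near_in_itvoo : c g \in `]0, d[ by rewrite in_itv.
    by apply: filterS => u; rewrite in_itv.
  by move/cvgrPdist_lt: cr => /(_ _ e0).
move=> /nbhs_ballP[k /= k0 Hk]; exists k => // w Mw; rewrite distrC => wk.
have [sd] := Hk (ext0 g w) wk; have [_ _ wE] := H _ sd.
by rewrite -(wE w Mw erefl).
Qed.

End Coordinates.

(** * The points that correspond under an isomorphism *)
Section Correspondence.
Variables (R : realType) (m n : nat) (M : set 'rV[R]_m) (N : set 'rV[R]_n).
Variables (hM : semialgebraic M) (hN : semialgebraic N).

(** phi carries the evaluation at x to the evaluation at z. *)
Definition corresponds (phi : Sstar hN -> Sstar hM) z x :=
  [/\ M z, N x & forall u : Sstar hN, ext0 (phi u) z = ext0 u x].

Lemma character_pullback (phi : {rmorphism Sstar hN -> Sstar hM}) z : M z ->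
  character (fun u => ext0 (phi u) z).
Proof.
move=> Mz; have [c1 cD cM] := character_eval_at hM Mz.
by split=> [|f g|f g]; rewrite ?rmorph1 ?rmorphD ?rmorphM ?c1 ?cD ?cM.
Qed.

Lemma corresponds_inj (phi : Sstar hN -> Sstar hM) z x x' :
  corresponds phi z x -> corresponds phi z x' -> x = x'.
Proof.
move=> [_ Nx zx] [_ Nx' zx']; apply: (chart_Sstar_inj (hM := hN)) => // i.
by rewrite -zx zx'.
Qed.

(** The image under phi of the distance to x is continuous at z, and its value at
   z' is the distance of the corresponding points x and x'. *)
Lemma corresponds_continuous (phi : Sstar hN -> Sstar hM) z x (e : R) :
  corresponds phi z x -> 0 < e -> exists2 d : R, 0 < d &
    forall z' x', corresponds phi z' x' -> `|z - z'| < d -> `|x - x'| < e.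
Proof.
move=> [Mz Nx zx] e0.
have [_ /continuous_onP ch _] := admissible_ext0 (phi (dist_Sstar hN x)).
have k0 : 0 < Num.min e 1 by rewrite lt_min e0 ltr01.
have [d d0 Hd] := ch z _ Mz k0; exists d => // z' x' [Mz' Nx' zx'] /(Hd _ Mz').
rewrite zx zx' ext0_dist // subrr normr0 (min_r ler01) sub0r normrN => H.
by rewrite distrC; apply: (dist_lt (hM := hN)) => //; apply: le_lt_trans H; exact: ler_norm.
Qed.

End Correspondence.

Lemma corresponds_sym (R : realType) m n (M : set 'rV[R]_m) (N : set 'rV[R]_n)
    (hM : semialgebraic M) (hN : semialgebraic N)
    (phi : Sstar hN -> Sstar hM) (psi : Sstar hM -> Sstar hN) z x :
  cancel psi phi -> corresponds phi z x -> corresponds psi x z.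
Proof. by move=> psiK [Mz Nx zx]; split=> // v; rewrite -zx psiK. Qed.

Section Isomorphism.
Variables (R : realType) (m n : nat) (M : set 'rV[R]_m) (N : set 'rV[R]_n).
Variables (hM : semialgebraic M) (hN : semialgebraic N).
Variables (phi : {rmorphism Sstar hN -> Sstar hM}) (psi : {rmorphism Sstar hM -> Sstar hN}).
Hypotheses (phiK : cancel phi psi) (psiK : cancel psi phi).

Let dM : definable R M. Proof. exact: hM. Qed.
Let dN : definable R N. Proof. exact: hN. Qed.

(** The function f = psi (distance to z) vanishes nowhere on N, since a zero x
   would correspond to z, but takes arbitrarily small values; and each element of
   S*(N) tends to its value under the character of z as f tends to 0. Therefore
   constant_on_fibers applies to the chart functions of N and shows that the level
   set f = s is a single point rho s for small s. By character_section a point of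
   M at distance s from z corresponds to rho s, so there is at most one; and
   density provides such points for arbitrarily small s, hence for all. *)
Lemma not_corresponds_metric_end z : M z ->
  (forall x, ~ corresponds phi z x) -> metric_end M z.
Proof.
move=> Mz nz; split=> //; pose g := dist_Sstar hM z; pose f := ext0 (psi g).
have af : admissible N f := admissible_ext0 (psi g).
have chx x (Nx : N x) := character_pullback psi Nx.
have chz := character_pullback phi Mz.
have gz : ext0 (phi (psi g)) z = 0 by rewrite psiK ext0_dist // subrr normr0 min_r.
have fpos x : N x -> 0 < f x.
  move=> Nx; rewrite lt_neqAle (character_dist_ge0 z (chx x Nx)) andbT eq_sym.
  apply/eqP => fx0; apply: (nz x); apply: (@corresponds_sym _ _ _ _ _ hN hM psi phi) => //.
  by split=> // v; exact: (character_dist_eq0 (chx x Nx) Mz fx0).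
have lim_f u : admissible N u -> exists l : R, forall e : R, 0 < e ->
    exists2 d : R, 0 < d & forall x, N x -> f x < d -> `|u x - l| < e.
  move=> au; pose U := Sstar_of hN au; exists (ext0 (phi U) z) => e e0.
  have [_ /continuous_onP cU _] := admissible_ext0 (phi U).
  have e20 : 0 < e / 2 by rewrite divr_gt0.
  have [d d0 Hd] := cU z (e / 2) Mz e20.
  pose k := Num.min d 1; have k0 : 0 < k by rewrite lt_min d0 ltr01.
  exists k => // x Nx fxk.
  have [|w [Mw gw Uw]] := character_dense (chx x Nx) g (phi U)
    (e := Num.min (k - f x) (e / 2)).
    by rewrite lt_min subr_gt0 fxk.
  move: gw Uw; rewrite !lt_min phiK (ext0_Sstar_of hN au Nx) => /andP[gw _] /andP[_ Uw].
  have wz : `|w - z| < d.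
    apply: (dist_lt (hM := hM)) => //; rewrite -/k -/g.
    by move: gw; rewrite -/(f x) ltr_norml => /andP[_]; rewrite ltrD2r.
  have := Hd w Mw; rewrite distrC => /(_ wz); move: Uw.
  by rewrite !ltr_norml => /andP[? ?] /andP[? ?]; apply/andP; split; lra.
have f_acc e : 0 < e -> exists2 x, N x & f x < e.
  move=> e0; have [x [Nx fx _]] := character_dense chz (psi g) 0 e0.
  by exists x => //; move: fx; rewrite gz subr0; apply: le_lt_trans; exact: ler_norm.
have [df _ _] := af.
have dim : definable R (fun s : R => exists x : 'rV[R]_n, N x /\ f x = s) by definability.
have f_onto : \forall s \near (0 : R)^'+, exists x, N x /\ f x = s.
  apply: definable_accumulation dim _ => e /f_acc[x Nx fx].
  by exists (f x); [rewrite add0r fpos|exists x].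
have f_inj : \forall s \near (0 : R)^'+, forall (i : option 'I_n) x x',
    N x -> N x' -> f x = s -> f x' = s ->
    ext0 (chart_Sstar hN i) x = ext0 (chart_Sstar hN i) x'.
  apply: filter_forall => i; apply: (constant_on_fibers dN af fpos lim_f).
  exact: admissible_ext0.
have [|rho [drho Hrho]] := definable_section dN df.
  apply: filterS2 f_onto f_inj => s [x [Nx fx]] inj; exists x; split=> // x' Nx' fx'.
  by apply: (chart_Sstar_inj (hM := hN)) => // i; exact: inj.
have crho := definable_row_continuous_at_right 0 drho.
have /at_rightP[d d0 {}Hrho] := at_right_and Hrho crho.
have sec s : 0 < s < d -> [/\ N (rho s), {for s, continuous rho} &
    forall w, N w -> ext0 (psi g) w = s -> w = rho s].
  by move=> sd; have [|[? ? ?] ?] := Hrho s; first by rewrite add0r.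
have corr w : M w -> 0 < ext0 g w < d -> corresponds phi w (rho (ext0 g w)).
  move=> Mw gw; split=> //; first by have [] := sec _ gw.
  move=> u; rewrite -[X in rho (ext0 (Sstar_val X) w)]psiK.
  by apply: (character_section (character_pullback phi Mw) sec); rewrite psiK.
have gE w s : M w -> `|w - z| = s -> s < 1 -> ext0 g w = s.
  by move=> Mw ws s1; rewrite ext0_dist // ws min_r // ltW.
have dS : definable R (fun s : R => exists w : 'rV[R]_m, M w /\ `|w - z| = s).
  by definability.
have onto : \forall s \near (0 : R)^'+, exists w : 'rV[R]_m, M w /\ `|w - z| = s.
  apply: definable_accumulation dS _ => e e0.
  pose k := Num.min e (Num.min d 1); have k0 : 0 < k by rewrite !lt_min e0 d0 ltr01.
  have [ke kd k1] : [/\ k <= e, k <= d & k <= 1].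
    by rewrite /k !ge_min !lexx !orbT.
  pose s := k / 2; have [|[Nr fr _] _] := Hrho s; first by rewrite /s; lra.
  have s0 : 0 < s / 2 by rewrite /s; lra.
  have [w [Mw + _]] := character_dense (chx _ Nr) g 0 s0.
  rewrite -/(f _) fr ext0_dist // ltr_norml => /andP[gw1 gw2].
  have w1 : Num.min 1 `|w - z| = `|w - z|.
    by apply: min_r; rewrite leNgt; apply/negP => lt1; move: gw2;
      rewrite (min_l (ltW lt1)) /s; lra.
  rewrite w1 in gw1 gw2; exists `|w - z|; last by exists w.
  by rewrite add0r; move: gw1 gw2; rewrite /s; lra.
have small : \forall s \near (0 : R)^'+, 0 < s < Num.min d 1.
  apply/at_rightP; exists (Num.min d 1); first by rewrite lt_min d0 ltr01.
  by move=> s; rewrite add0r.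
apply: filterS2 onto small => s [w [Mw ws]] /andP[s0]; rewrite lt_min => /andP[sd s1].
exists w; split=> // w' Mw' w's.
have Cw : corresponds phi w (rho s).
  by rewrite -(gE w s) //; apply: corr => //; rewrite (gE w s) ?s0.
have Cw' : corresponds phi w' (rho s).
  by rewrite -(gE w' s) //; apply: corr => //; rewrite (gE w' s) ?s0.
exact: corresponds_inj (corresponds_sym psiK Cw') (corresponds_sym psiK Cw).
Qed.

End Isomorphism.

Section Transfer.
Variables (R : realType) (m n : nat) (M : set 'rV[R]_m) (N : set 'rV[R]_n).
Variables (hM : semialgebraic M) (hN : semialgebraic N).
Variables (phi : {rmorphism Sstar hN -> Sstar hM}) (psi : {rmorphism Sstar hM -> Sstar hN}).
Hypotheses (phiK : cancel phi psi) (psiK : cancel psi phi).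

Let dM : definable R M. Proof. exact: hM. Qed.
Let dN : definable R N. Proof. exact: hN. Qed.

(** The arc of M at z consists of points that are not ends, except z. These
   correspond to points of N, where they form the level sets of
   f = psi (distance to z); and f is positive on N except at x. *)
Lemma corresponds_metric_end z x :
  corresponds phi z x -> metric_end M z -> metric_end N x.
Proof.
move=> zx Ez; have [Mz Nx zxE] := zx; pose g := dist_Sstar hM z; pose f := ext0 (psi g).
have fx0 : f x = 0 by rewrite /f -zxE psiK ext0_dist // subrr normr0 min_r.
have [df cf _] := admissible_ext0 (psi g).
have chx y (Ny : N y) := character_pullback psi Ny.
have f0 y : N y -> y <> x -> 0 < f y.
  move=> Ny yx; rewrite lt_neqAle (character_dist_ge0 z (chx y Ny)) andbT eq_sym.
  apply/eqP => fy0; apply: yx; apply: (@corresponds_inj _ _ _ _ _ hM hN phi z) => //.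
  apply: (@corresponds_sym _ _ _ _ _ hN hM psi phi) => //.
  by split=> // v; exact: (character_dist_eq0 (chx y Ny) Mz fy0).
have [rho [drho arc]] := metric_end_arc dM Ez.
have crho := definable_row_continuous_at_right 0 drho.
have /at_rightP[d' d'0 {}arc] := at_right_and arc crho.
have [d'' d''0 iso] := metric_end_isolated dM Ez.
pose d := Num.min (Num.min d' d'') 1.
have d0 : 0 < d by rewrite !lt_min d'0 d''0 ltr01.
have [dd' dd'' d1] : [/\ d <= d', d <= d'' & d <= 1].
  by rewrite /d !ge_min !lexx !orbT.
have rhoz s : 0 < s < d -> `|rho s - z| = s.
  by move=> sd; have [|[_ ? _] _] := arc s; first by rewrite add0r; lra.
have sec s : 0 < s < d -> [/\ M (rho s), {for s, continuous rho} &
    forall w, M w -> ext0 g w = s -> w = rho s].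
  move=> sd; have [|[Mr _ ur] cr] := arc s; first by rewrite add0r; lra.
  split=> // w Mw gw; apply: ur => //; move: gw; rewrite ext0_dist //.
  by case: (leP 1 `|w - z|) => // _ s1; move: sd; rewrite -s1; lra.
have corr y : N y -> 0 < f y < d -> corresponds phi (rho (f y)) y.
  move=> Ny fy; apply: (@corresponds_sym _ _ _ _ _ hN hM psi phi) => //.
  split=> //; first by have [] := sec _ fy.
  exact: (character_section (chx y Ny) sec fy).
have near_d : \forall s \near (0 : R)^'+, 0 < s < d.
  by apply/at_rightP; exists d => // s; rewrite add0r.
have [|rhoN [drhoN]] := definable_section dN df.
  apply: filterS near_d => s sd.
  have [Mr _ _] := sec _ sd.
  have nE : ~ metric_end M (rho s) by apply: iso => //; rewrite rhoz //; lra.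
  have [y ry] : exists y, corresponds phi (rho s) y.
    apply: contrapT => ny; apply: nE.
    by apply: (not_corresponds_metric_end phiK psiK Mr) => y ?; apply: ny; exists y.
  have [_ Ny yE] := ry.
  have gr : ext0 g (rho s) = s by rewrite ext0_dist // rhoz // min_r //; lra.
  exists y; split=> //; first by rewrite -yE psiK.
  move=> y' Ny' fy'; apply: (corresponds_inj _ ry) => //.
  by rewrite -{1}fy'; apply: corr => //; rewrite /f fy'.
move=> HrhoN; have /at_rightP[e0 e00 H] := at_right_and HrhoN near_d.
have {}H s : 0 < s < e0 -> [/\ N (rhoN s), f (rhoN s) = s,
    0 < s < d & forall y, N y -> f y = s -> y = rhoN s].
  by move=> se; have [|[]] := H s; first by rewrite add0r.
apply: (@metric_end_chart _ _ N x rhoN) => //.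
- apply/cvgrPdist_lt => e e_gt0.
  have [k k0 Hk] := corresponds_continuous zx e_gt0.
  apply/at_rightP; exists (Num.min k e0); first by rewrite lt_min k0.
  move=> s; rewrite add0r lt_min => /and3P[s0 sk se].
  have [Ns fs sd _] := H s (introT andP (conj s0 se)).
  apply: (Hk (rho s)); last by rewrite distrC rhoz.
  by rewrite -{1}fs; apply: corr; rewrite ?fs.
- apply/at_rightP; exists e0 => // s; rewrite add0r => se.
  have [Ns fs sd _] := H s se; split=> // sx; move: fs; rewrite sx fx0 => s0.
  by move: se; rewrite -s0 ltxx.
- move=> e e_gt0; have k0 : 0 < Num.min e e0 by rewrite lt_min e_gt0.
  move/continuous_onP: cf => /(_ x _ Nx k0)[r r0 Hr]; exists r => // w Nw wx.
  rewrite distrC => /(Hr w Nw); rewrite -/(f x) fx0 sub0r normrN -/(f w).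
  rewrite (gtr0_norm (f0 _ Nw wx)) lt_min => /andP[we we0].
  exists (f w); first by rewrite f0.
  by have [_ _ _] := H (f w) (introT andP (conj (f0 _ Nw wx) we0)); apply.
Qed.

End Transfer.

(** The graph of the bijection is cut out of the product by the equations which
   say that the chart functions of M take corresponding values. *)
Lemma homeomorphic_of_isomorphism (R : realType) m n (M : set 'rV[R]_m) (N : set 'rV[R]_n)
    (hM : semialgebraic M) (hN : semialgebraic N) (phi : {rmorphism Sstar hN -> Sstar hM})
    (psi : {rmorphism Sstar hM -> Sstar hN}) :
  cancel phi psi -> cancel psi phi ->
  semialgebraic_homeomorphic (N `\` metric_end N) (M `\` metric_end M).
Proof.
move=> phiK psiK; set N' := N `\` _; set M' := M `\` _.
have dM : definable R M by exact: hM.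
have dN : definable R N by exact: hN.
have dEM := definable_metric_end dM; have dEN := definable_metric_end dN.
have exh (x : N') : exists z : M', corresponds phi (\val z) (\val x).
  have [Nx nEx] := set_type_mem x.
  have [z xz] : exists z, corresponds psi (\val x) z.
    apply: contrapT => nz; apply: nEx.
    by apply: (not_corresponds_metric_end psiK phiK Nx) => z ?; apply: nz; exists z.
  have zx := corresponds_sym phiK xz.
  have M'z : M' z.
    split; first by case: zx.
    by move=> Ez; apply: nEx; exact: (corresponds_metric_end phiK psiK zx Ez).
  by exists (to_sub M'z).
have exg (z : M') : exists x : N', corresponds phi (\val z) (\val x).
  have [Mz nEz] := set_type_mem z.
  have [x zx] : exists x, corresponds phi (\val z) x.
    apply: contrapT => nx; apply: nEz.
    by apply: (not_corresponds_metric_end phiK psiK Mz) => x ?; apply: nx; exists x.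
  have N'x : N' x.
    split; first by case: zx.
    move=> Ex; apply: nEz.
    exact: (corresponds_metric_end psiK phiK (corresponds_sym psiK zx) Ex).
  by exists (to_sub N'x).
have [h hE] := choice exh; have [g gE] := choice exg.
have ch : continuous h.
  apply/continuous_sub_subP => x e e0.
  have [d d0 Hd] := corresponds_continuous (corresponds_sym psiK (hE x)) e0.
  by exists d => // x'; apply: Hd; exact: corresponds_sym psiK (hE x').
have cg : continuous g.
  apply/continuous_sub_subP => z e e0.
  have [d d0 Hd] := corresponds_continuous (gE z) e0.
  by exists d => // z'; apply: Hd; exact: gE.
have hK : cancel h g.
  by move=> x; apply: val_inj; exact: (corresponds_inj (gE (h x)) (hE x)).
have gK : cancel g h.
  move=> z; apply: val_inj.
  exact: (corresponds_inj (corresponds_sym psiK (hE (g z))) (corresponds_sym psiK (gE z))).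
exists h; split; last by exists g.
split; first by apply/continuous_subP => x e e0; move/continuous_sub_subP: ch; exact.
apply/definable_graphP.
have dpull (i : option 'I_m) : definable R (fun p : 'rV[R]_n * 'rV[R]_m =>
    ext0 (psi (chart_Sstar hM i)) p.1 = ext0 (chart_Sstar hM i) p.2).
  have [d1 _ _] := admissible_ext0 (psi (chart_Sstar hM i)).
  have [d2 _ _] := admissible_ext0 (chart_Sstar hM i).
  by definability.
apply: (definable_ext (P := fun p : 'rV[R]_n * 'rV[R]_m =>
    (N p.1 /\ ~ metric_end N p.1) /\ ((M p.2 /\ ~ metric_end M p.2) /\
    (ext0 (psi (chart_Sstar hM None)) p.1 = ext0 (chart_Sstar hM None) p.2 /\
     forall i : 'I_m, ext0 (psi (chart_Sstar hM (Some i))) p.1 =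
       ext0 (chart_Sstar hM (Some i)) p.2)))).
  have dN1 := dpull None; have dS i := dpull (Some i).
  apply: definable_and; first by definability.
  apply: definable_and; first by definability.
  by apply: definable_and => //; apply: definable_forall_ord.
move=> [x z] /=; split=> [[N'x [[Mz nEz] [x0 xi]]]|[N'x ->]].
  exists N'x; have [Mh Nx hx] := corresponds_sym psiK (hE (to_sub N'x)).
  apply: (chart_Sstar_inj (hM := hM)) => // i; rewrite -hx /=.
  by case: i => [i|]; rewrite ?x0 ?xi.
have [Nx Mh hx] := corresponds_sym psiK (hE (to_sub N'x)).
split; first exact: N'x.
split; first exact: (set_type_mem (h (to_sub N'x))).
by split=> [|i]; exact: hx.
Qed.

(** * Extension of functions over the end points *)
Section Extension.
Variables (R : realType) (m : nat) (M : set 'rV[R]_m).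
Hypothesis dM : definable R M.
Let M' := M `\` metric_end M.

Let dE : definable R (metric_end M) := definable_metric_end dM.
Let dM' : definable R M'.
Proof. by rewrite /M' /setD /mkset; definability. Qed.

Lemma metric_end_limit y : metric_end M y ->
  exists rho : R -> 'rV[R]_m, definable_fun R rho /\
    \forall s \near (0 : R)^'+, [/\ M' (rho s), `|rho s - y| = s &
      forall w, M w -> `|w - y| = s -> w = rho s].
Proof.
move=> Ey; have [rho [drho arc]] := metric_end_arc dM Ey; exists rho; split=> //.
have [d d0 iso] := metric_end_isolated dM Ey.
have near_d : \forall s \near (0 : R)^'+, 0 < s < d.
  by apply/at_rightP; exists d => // s; rewrite add0r.
apply: filterS2 arc near_d => s [Mr rs ur] sd; split=> //; split=> //.
by apply: iso => //; rewrite rs.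
Qed.

Lemma nonends_dense y (d : R) : M y -> 0 < d -> exists2 w, M' w & `|y - w| < d.
Proof.
move=> My d0; have [Ey|nEy] := pselect (metric_end M y); last first.
  by exists y => //; rewrite subrr normr0.
have [rho [_ /at_rightP[d' d'0 arc]]] := metric_end_limit Ey.
have m0 : 0 < Num.min d d' by rewrite lt_min d0.
have [md md'] : Num.min d d' <= d /\ Num.min d d' <= d'.
  by rewrite !ge_min !lexx orbT.
have [|M'r rs _] := arc (Num.min d d' / 2); first by rewrite add0r; lra.
by exists (rho (Num.min d d' / 2)) => //; rewrite distrC rs; lra.
Qed.

Lemma continuous_on_eq F G : continuous_on M F -> continuous_on M G ->
  (forall w, M' w -> F w = G w) -> forall y, M y -> F y = G y.
Proof.
move=> /continuous_onP cF /continuous_onP cG FG y My; apply/eqP.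
rewrite -subr_eq0 -normr_le0; apply/ler_addgt0Pr => e e0; rewrite add0r.
have e20 : 0 < e / 2 by rewrite divr_gt0.
have [d d0 Hd] := cF y _ My e20; have [d' d'0 Hd'] := cG y _ My e20.
have [|w M'w] := nonends_dense (d := Num.min d d') My; first by rewrite lt_min d0.
rewrite lt_min => /andP[yd yd']; have Mw : M w by case: M'w.
move: (Hd w Mw yd) (Hd' w Mw yd'); rewrite (FG _ M'w) !ltr_norml ler_norml.
by move=> /andP[? ?] /andP[? ?]; apply/andP; split; lra.
Qed.

(** The value at y is the limit of F at y; it exists at an end because F composed
   with the arc at y is a bounded definable function of one variable. *)
Lemma admissible_extension F : admissible M' F ->
  exists2 G, admissible M G & forall w, M' w -> G w = F w.
Proof.
move=> [dF /continuous_onP cF [C bF]].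
pose L (y : 'rV[R]_m) (l : R) := M y /\ forall e : R, 0 < e -> exists d : R, 0 < d /\
  forall w : 'rV[R]_m, M' w -> `|y - w| < d -> `|l - F w| < e.
have dL : definable R (fun p : 'rV[R]_m * R => L p.1 p.2).
  by rewrite /L; definability.
have uL y l l' : L y l -> L y l' -> l = l'.
  move=> [My yl] [_ yl']; apply/eqP.
  rewrite -subr_eq0 -normr_le0; apply/ler_addgt0Pr => e e0; rewrite add0r.
  have e20 : 0 < e / 2 by rewrite divr_gt0.
  have [d [d0 Hd]] := yl _ e20; have [d' [d'0 Hd']] := yl' _ e20.
  have [|w M'w] := nonends_dense (d := Num.min d d') My; first by rewrite lt_min d0.
  rewrite lt_min => /andP[yd yd'].
  move: (Hd w M'w yd) (Hd' w M'w yd'); rewrite !ltr_norml ler_norml.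
  by move=> /andP[? ?] /andP[? ?]; apply/andP; split; lra.
have LF y : M' y -> L y (F y).
  move=> M'y; split; first by case: M'y.
  by move=> e e0; have [d d0 Hd] := cF y e M'y e0; exists d.
have exL y : M y -> exists l, L y l.
  move=> My; have [Ey|nEy] := pselect (metric_end M y); last first.
    by exists (F y); apply: LF.
  have [rho [drho arc]] := metric_end_limit Ey.
  have dFr : definable_fun R (fun t : R => F (rho t)) by definability.
  have bFr : \forall t \near (0 : R)^'+, `|F (rho t)| <= C.
    by apply: filterS arc => t [M'r _ _]; exact: bF.
  have [l /cvgrPdist_lt Hl] := definable_cvg_at_right dFr bFr.
  exists l; split=> // e /Hl {}Hl.
  have /at_rightP[d d0 H] := at_right_and arc Hl.
  exists d; split=> // w M'w yw; rewrite distrC in yw.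
  have w0 : 0 < `|w - y|.
    rewrite normr_gt0 subr_eq0; apply/eqP => wy; case: M'w => _; apply.
    by rewrite wy.
  have [|[_ _ ur] lF] := H `|w - y|; first by rewrite add0r w0.
  by rewrite (ur w) //; case: M'w.
have [G [dG GL]] := definable_choice (0 : R) dL uL.
have LG y : M y -> L y (G y) by move=> /exL[l Ll]; rewrite (GL _ _ Ll).
exists G; last by move=> w M'w; apply: GL; exact: LF.
split=> //.
  apply/continuous_onP => y e My e0.
  have e20 : 0 < e / 2 by rewrite divr_gt0.
  have [_ /(_ _ e20)[d [d0 Hd]]] := LG _ My; exists (d / 2); first by rewrite divr_gt0.
  move=> y' My' yy'; have [_ /(_ _ e20)[d' [d'0 Hd']]] := LG _ My'.
  have [|w M'w] := nonends_dense (d := Num.min d' (d / 2)) My'.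
    by rewrite lt_min d'0 divr_gt0.
  rewrite lt_min => /andP[wd' wd].
  have yw : `|y - w| < d.
    rewrite -(subrK y' y) -addrA; apply: le_lt_trans (ler_normD _ _) _.
    by rewrite [X in _ < X]splitr ltrD.
  move: (Hd w M'w yw) (Hd' w M'w wd'); rewrite !ltr_norml.
  by move=> /andP[? ?] /andP[? ?]; apply/andP; split; lra.
exists (C + 1) => y My; have [_ /(_ _ ltr01)[d [d0 Hd]]] := LG _ My.
have [w M'w yw] := nonends_dense My d0.
have := Hd w M'w yw; have := bF _ M'w; rewrite !ler_norml ltr_norml.
by move=> /andP[? ?] /andP[? ?]; apply/andP; split; lra.
Qed.

End Extension.

Section Pullback.
Variables (R : realType) (m n : nat) (M : set 'rV[R]_m) (N : set 'rV[R]_n).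
Variables (hM : semialgebraic M) (hN : semialgebraic N).
Let M' := M `\` metric_end M.
Let N' := N `\` metric_end N.

Lemma pullback_extension (k : M' -> N') : semialgebraic_map (fun w => \val (k w)) ->
  forall u : Sstar hN, exists v : Sstar hM,
    forall w : M', ext0 v (\val w) = ext0 u (\val (k w)).
Proof.
move=> [/continuous_subP ck /definable_graphP sk] u.
have [du cu [C bu]] := admissible_ext0 u.
have dM : definable R M by exact: hM.
have dE := definable_metric_end dM.
have dM' : definable R M' by rewrite /M' /setD /mkset; definability.
pose F : 'rV[R]_m -> R := ext0 (fun w : M' => ext0 u (\val (k w))).
have N'N (x : N') : N (\val x) by case: (set_type_mem x).
have aF : admissible M' F.
  split.
  - apply: (definable_ext (P := fun p : 'rV[R]_m * R => (exists x : 'rV[R]_n,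
        (exists Mw : M' p.1, x = \val (k (to_sub Mw))) /\ ext0 u x = p.2) \/
        (~ M' p.1 /\ p.2 = 0))).
      apply: definable_or; last by definability.
      apply: definable_exists; apply: definable_and; last by definability.
      apply: (definable_comp (f := fun p : 'rV[R]_m * R * 'rV[R]_n => (p.1.1, p.2)) sk).
      by definability.
    move=> [w r] /=; rewrite /F; split=> [[[_ [[Mw ->] <-]]|[nMw ->]]|<-].
    + by rewrite (ext0_to_sub _ Mw).
    + by rewrite /ext0; case: pselect.
    + have [Mw|nMw] := pselect (M' w).
        left; rewrite (ext0_to_sub _ Mw).
        by exists (\val (k (to_sub Mw))); split=> //; exists Mw.
      by right; split=> //; rewrite /ext0; case: pselect.
  - apply/continuous_onP => w e M'w e0.
    move/continuous_onP: cu => /(_ _ e (N'N (k (to_sub M'w))) e0)[d d0 Hd].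
    have [d' d'0 Hd'] := ck (to_sub M'w) d d0.
    exists d' => // w' M'w' ww'; rewrite /F (ext0_to_sub _ M'w) (ext0_to_sub _ M'w').
    by apply: Hd; [exact: N'N|exact: (Hd' (to_sub M'w'))].
  - by exists C => w M'w; rewrite /F (ext0_to_sub _ M'w); apply: bu; exact: N'N.
have [G aG GF] := admissible_extension dM aF.
exists (Sstar_of hM aG) => w; have M'w := set_type_mem w.
rewrite ext0_Sstar_of; last by case: M'w.
by rewrite GF // /F ext0E.
Qed.

Lemma Sstar_eq_nonends (f g : Sstar hM) :
  (forall w : M', ext0 f (\val w) = ext0 g (\val w)) -> f = g.
Proof.
move=> fg; apply: Sstar_eqP; have dM : definable R M by exact: hM.
have [_ cf _] := admissible_ext0 f; have [_ cg _] := admissible_ext0 g.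
by apply: (continuous_on_eq dM cf cg) => w M'w; exact: (fg (to_sub M'w)).
Qed.

End Pullback.

Lemma semialgebraic_homeo_inverse (R : realType) m n (M : set 'rV[R]_m) (N : set 'rV[R]_n)
    (f : M -> N) (g : N -> M) : cancel f g -> cancel g f -> continuous g ->
  semialgebraic_map (fun x => \val (f x)) -> semialgebraic_map (fun y => \val (g y)).
Proof.
move=> fK gK cg [_ /definable_graphP sf]; split.
  by apply/continuous_subP => y e e0; move/continuous_sub_subP: cg; exact.
apply/definable_graphP.
have sf' : definable R (fun p : 'rV[R]_n * 'rV[R]_m =>
    exists Mx : M p.2, p.1 = \val (f (to_sub Mx))).
  by apply: (definable_comp (f := fun p : 'rV[R]_n * 'rV[R]_m => (p.2, p.1)) sf); definability.
apply: (definable_ext sf') => -[y x] /=; split=> [[Mx ->]|[Ny ->]].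
  exists (set_type_mem _); rewrite (_ : to_sub _ = f (to_sub Mx)); first by rewrite fK.
  exact: val_inj.
exists (set_type_mem _); rewrite (_ : to_sub _ = g (to_sub Ny)); first by rewrite gK.
exact: val_inj.
Qed.

Lemma isomorphism_of_homeomorphic (R : realType) m n (M : set 'rV[R]_m) (N : set 'rV[R]_n)
    (hM : semialgebraic M) (hN : semialgebraic N) :
  semialgebraic_homeomorphic (N `\` metric_end N) (M `\` metric_end M) ->
  exists phi : {rmorphism Sstar hN -> Sstar hM}, bijective phi.
Proof.
move=> [f [sf [g [fK gK cf cg]]]].
have sg := semialgebraic_homeo_inverse fK gK cg sf.
have [phi phiE] := choice (@pullback_extension R m n M N hM hN g sg).
have [psi psiE] := choice (@pullback_extension R n m N M hN hM f sf).
have MM (w : M `\` metric_end M) : M (\val w) by case: (set_type_mem w).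
have NN (x : N `\` metric_end N) : N (\val x) by case: (set_type_mem x).
have phiB : zmod_morphism phi.
  move=> u v; apply: Sstar_eq_nonends => w.
  by rewrite ext0B // !phiE ext0B.
have phiM : monoid_morphism phi.
  split=> [|u v]; apply: Sstar_eq_nonends => w; rewrite ?ext0M // !phiE ?ext0M //.
  by rewrite !ext01.
pose phi' : {rmorphism Sstar hN -> Sstar hM} := HB.pack phi
  (GRing.isZmodMorphism.Build _ _ phi phiB) (GRing.isMonoidMorphism.Build _ _ phi phiM).
exists phi'; exists psi => [u|v].
  by apply: Sstar_eq_nonends => x; rewrite psiE /= phiE fK.
by apply: Sstar_eq_nonends => w; rewrite /= phiE psiE gK.
Qed.

Theorem theorem2 (R : realType) (m n : nat)
    (M : set 'rV[R]_m) (N : set 'rV[R]_n)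
    (hM : semialgebraic M) (hN : semialgebraic N) :
  (exists phi : {rmorphism Sstar hN -> Sstar hM}, bijective phi) <->
  semialgebraic_homeomorphic (N `\` end_points N) (M `\` end_points M).
Proof.
rewrite (end_pointsE hM) (end_pointsE hN); split; last exact: isomorphism_of_homeomorphic.
move=> [phi [psi phiK psiK]].
have psiB : zmod_morphism psi.
  by move=> a b; apply: (can_inj phiK); rewrite rmorphB !psiK.
have psiM : monoid_morphism psi.
  by split=> [|a b]; apply: (can_inj phiK); rewrite ?rmorph1 ?rmorphM !psiK.
pose psi' : {rmorphism Sstar hM -> Sstar hN} := HB.pack psi
  (GRing.isZmodMorphism.Build _ _ psi psiB) (GRing.isMonoidMorphism.Build _ _ psi psiM).
exact: (homeomorphic_of_isomorphism (psi := psi') phiK psiK).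
Qed.
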